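(* Let $H$ be a locally compact Abelian group with Haar measure $\theta$, whose topology is given by a translation invariant complete metric $d$, and let $A$ be an automorphism of $H$ (as topological group) which is a contraction relative to $d$, with modulus $\alpha$. Let $F$ be a (nonempty) compact family of affine mappings of $H$, all of the form $x\mapsto Ax+v$ with $v\in H$, with attractor $W\subset H$, and let $F_H=\{f(0)\mid f\in F\}$ be the corresponding compact set of translations. Let $\nu=h\theta$ be an absolutely continuous probability measure on $H$ supported on $F_H$, where $h\in L^1(H)$, $h\ge 0$. Then: 1. There is a unique non-negative function $g\in L^1(H)$ which satisfies $$g(x)=\alpha\int_H g(A^{-1}(x-v))\,h(v)\,\mathrm{d}\theta(v)$$ (for almost all $x\in H$) with normalization $\int_H g\,\mathrm{d}\theta=1$. 2. $g=\mathop{\ast}_{\ell=0}^{\infty}\alpha^{\ell}(A^{\ell}.h)$, with convergence in the $L^1$-norm, and $\mathrm{supp}(g)\subset W$. 3. The Fourier transform of $g$ is the continuous function $\widehat{g}=\prod_{\ell=0}^{\infty}\widehat{h}\circ(A^T)^{\ell}$, with uniform convergence of the product. 4. If $h\in L^1(H)\cap L^{\infty}(H)$, then $g$ is continuous on $H$ (i.e. has a continuous representative).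
   Context: The modulus $\alpha>0$ of $A$ is defined by $\theta\circ A^{-1}=\alpha\theta$. A contraction is a Lipschitz map with Lipschitz constant $<1$. $F$ is compact in $C(H,H)$ with the compact-open topology; its attractor is the unique nonempty compact $W\subset H$ with $W=\bigcup_{f\in F}f(W)$. For a function $h$ on $H$, $(A.h)(x)=h(A^{-1}x)$, so $A^\ell.h=h\circ A^{-\ell}$. $h\theta$ is the measure with density $h$ with respect to $\theta$. $\ast$ is convolution in $L^1(H)$ and $\mathop{\ast}_{\ell=0}^\infty f_\ell$ is the limit of the finite convolutions $f_0*f_1*\cdots*f_n$ as $n\to\infty$. The Fourier transform on the dual group $\widehat{H}$ is $\widehat{h}(k)=\int_H\overline{\langle k,x\rangle}h(x)\,\mathrm{d}\theta(x)$, and $A^T$ is the automorphism of $\widehat{H}$ given by $\langle A^Tk,x\rangle=\langle k,Ax\rangle$. *)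

(* Defs.v *)
From HB Require Import structures.
From mathcomp Require Import all_boot all_order all_algebra.
From mathcomp Require Import complex.
From mathcomp Require Import all_classical all_reals all_analysis.

Set Implicit Arguments.
Unset Strict Implicit.
Unset Printing Implicit Defensive.

Import Order.TTheory GRing.Theory Num.Theory.
Import numFieldTopology.Exports numFieldNormedType.Exports.

Local Open Scope classical_set_scope.
Local Open Scope ring_scope.

(* The Borel sigma-algebra.  A measurable type must be pointed, which a
   [topologicalZmodType] is not; the point is chosen to be 0. *)
Definition borel (H : topologicalZmodType) : Type := H.

Section borel.
Context (H : topologicalZmodType).

HB.instance Definition _ := Choice.on (borel H).
HB.instance Definition _ := isPointed.Build (borel H) (0 : H).
HB.instance Definition _ := @isMeasurable.Build (sigma_display (@open H))
  (borel H) <<s @open H >> (@sigma_algebra0 _ setT (@open H))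
  (@sigma_algebraC (borel H) (@open H))
  (@sigma_algebra_bigcup _ setT (@open H)).

End borel.

Section group.
Context {R : realType} {H : topologicalZmodType}.
Implicit Types (A Ai : H -> H) (F : set (H -> H)) (W : set H).

(* The [metricType] of the library cannot be joined with
   [topologicalZmodType] (the hierarchy lacks the intermediate joins), so the
   distance is explicit. *)
Section distance.
Variable d : H -> H -> R.

Definition is_metric :=
  [/\ forall x y, 0 <= d x y, forall x y, d x y = 0 <-> x = y,
      forall x y, d x y = d y x &
      forall x y z, d x z <= d x y + d y z].

Definition metrizes := forall (x : H) (U : set H),
  nbhs x U <-> exists2 r, 0 < r & [set y | d x y < r] `<=` U.

Definition translation_invariant_metric :=
  forall x y z : H, d (x + z) (y + z) = d x y.

Definition complete_metric := forall u : nat -> H,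
  (forall e : R, 0 < e -> exists N, forall m n,
     (N <= m)%N -> (N <= n)%N -> d (u m) (u n) < e) ->
  exists x : H, u @ \oo --> x.

Definition metric_contraction A :=
  exists2 q : R, 0 <= q < 1 & forall x y, d (A x) (A y) <= q * d x y.

End distance.

(* [Ai] is the inverse of [A]. *)
Definition topgroup_automorphism A Ai :=
  [/\ {morph A : x y / x + y}, cancel A Ai, cancel Ai A,
      continuous A & continuous Ai].

Definition is_attractor F W :=
  [/\ W !=set0, compact W & W = \bigcup_(f in F) (f @` W)].

Variable theta : {measure set (borel H) -> \bar R}.

Record is_haar : Prop := {
  haar_neq0 : (0 < theta [set: H])%E;
  haar_translation : forall (x : H) (B : set (borel H)), measurable B ->
    theta [set x + b | b in (B : set H)] = theta B;
  haar_compact : forall K : set H, compact K -> (theta K < +oo)%E;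
  haar_outer_regular : forall B : set (borel H), measurable B ->
    theta B =
    ereal_inf [set theta U | U in [set U : set H | open U /\ B `<=` U]];
  haar_inner_regular : forall U : set H, open U ->
    theta U =
    ereal_sup [set theta K | K in [set K : set H | compact K /\ K `<=` U]]
}.

(* theta o A^-1 = alpha theta, as set functions; [A @^-1` B] is A^-1(B). *)
Definition is_modulus A (alpha : R) :=
  0 < alpha /\ forall B : set (borel H), measurable B ->
    theta (A @^-1` B) = (alpha%:E * theta B)%E.

(* Complement of the largest open set on which [g] vanishes almost
   everywhere; it depends only on the a.e. class of [g]. *)
Definition ess_support (g : borel H -> R) : set H :=
  [set x | forall U : set H, open U -> U x ->
     ~ {ae theta, forall y, U y -> g y = 0}].

(* The almost everywhere defined convolution of L^1 functions; the real
   integral is 0 at the negligibly many x where the integral diverges. *)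
Definition convol (f g : borel H -> R) : borel H -> R :=
  fun x : H => \int[theta]_v (f (x - (v : H)) * g v).

(* f 0 * f 1 * ... * f n *)
Fixpoint convol_upto (f : nat -> borel H -> R) (n : nat) : borel H -> R :=
  if n is m.+1 then convol (convol_upto f m) (f m.+1) else f 0%N.

Definition L1_cvg (u : nat -> borel H -> R) (g : borel H -> R) :=
  [/\ forall n, u n \in Lfun theta 1%E, g \in Lfun theta 1%E &
      'N[theta]_1[EFin \o (u n \- g)%R]%E @[n --> \oo] --> 0%E].

(* alpha^l (A^l . h), where A^l . h = h o A^(-l) *)
Definition rescaled Ai (alpha : R) (h : borel H -> R) (l : nat) : borel H -> R :=
  fun x => alpha ^+ l * h (iter l Ai x).

(* The normalized non-negative L^1 solutions of the refinement equation.
   L^1 is represented by functions up to a.e. equality. The integrals are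
   extended-real valued, so the equation includes their finiteness a.e. *)
Definition refinement_solution Ai (alpha : R) (h g : borel H -> R) :=
  [/\ g \in Lfun theta 1%E,
      {ae theta, forall x, 0 <= g x},
      {ae theta, forall x : borel H, (g x)%:E =
         alpha%:E * \int[theta]_v (g (Ai ((x : H) - (v : H))) * h v)%:E}%E &
      (\int[theta]_x (g x)%:E = 1)%E].

(* The dual group: continuous homomorphisms from H to the unit circle, as a
   subspace of the complex-valued functions with the compact-open topology. *)
Definition dual_group : set {compact-open, H -> R[i]^o} :=
  [set k : H -> R[i]^o | [/\ continuous k,
     forall x y, k (x + y) = k x * k y & forall x, `|k x| = 1]].

(* A^T, given by <A^T k, x> = <k, A x> *)
Definition dual_map A (k : {compact-open, H -> R[i]^o}) :
  {compact-open, H -> R[i]^o} := fun x => k (A x).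

Definition complex_integral (f : borel H -> R[i]) : R[i] :=
  Complex (\int[theta]_x complex.Re (f x)) (\int[theta]_x complex.Im (f x)).

Definition fourier (g : borel H -> R) (k : {compact-open, H -> R[i]^o}) :
    R[i]^o :=
  complex_integral (fun x => conjc (k x) * real_complex R (g x)).

End group.

(* Main.v *)
(** Write T f = alpha (f o A^-1), which maps probability densities to
    probability densities and is multiplicative for convolution, and
    G_n = h * T h * ... * T^n h. Then G_(n+k+1) = G_n * T^(n+1) G_k.

    Translating G_n by v moves it, in L1, by at most what the same translation
    does to h, namely w(v), and w(v) -> 0 as v -> 0. Hence for every probability
    density phi,
      || G_n * T^(n+1) phi - G_n || <= \int w(A^(n+1) v) phi(v) dv.
    For phi = G_k, which is supported in a bounded set independent of k, the
    right-hand side tends to 0 uniformly in k, because A is a contraction: so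
    (G_n) is Cauchy in L1. For an arbitrary normalized solution phi of the
    refinement equation phi = h * T phi, the left-hand side is || phi - G_n ||
    and the right-hand side tends to 0 by dominated convergence: so the solution
    is unique. The limit g of (G_n) is a solution since G_(n+1) = h * T G_n.

    The powers of A^-1 blow up a compact neighbourhood of 0 to the whole group,
    which is therefore sigma-compact and second countable: this gives both the
    sigma-finiteness of the Haar measure and the measurability of
    (x, y) |-> x - y that Tonelli's theorem requires. *)

Require Import Defs.
From HB Require Import structures.
From mathcomp Require Import all_boot all_order all_algebra.
From mathcomp Require Import complex.
From mathcomp Require Import all_classical all_reals all_analysis.
From mathcomp Require Import measurable_realfun ess_sup_inf.
From mathcomp Require Import ring lra.

Set Implicit Arguments.
Unset Strict Implicit.
Unset Printing Implicit Defensive.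

Import Order.TTheory GRing.Theory Num.Theory.
Import numFieldTopology.Exports numFieldNormedType.Exports.

Local Open Scope classical_set_scope.
Local Open Scope ring_scope.

(** * Metrizable topological groups and their Borel sets *)

(** Almost everywhere statements are traded early for pointwise ones. [h] is replaced by a
    representative that is non-negative everywhere and vanishes at every point off F_H, so that
    supports can be followed point by point: adding A^(k+1) y, for a fixed y in [W], sends the
    support of G_k into [W], whence a bound independent of k. Returning to the given [h] is cheap,
    because v |-> x - v preserves null sets, so a convolution at every x depends only on the a.e.
    classes of its factors.

    That w(v) -> 0 comes from the regularity of the Haar measure, for indicators first.

    The remaining claims rest on L1 convergence and on g = h * T g. The transform of G_n is a
    partial product, and transforms differ by at most twice the L1 distance, uniformly in the
    character, as its real and imaginary parts are bounded by 1. Continuity of the transform holds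
    because g lives on the compact [W] and the compact-open topology controls characters uniformly
    there. If [h] is bounded, h * T g convolves a bounded function with an integrable one, hence is
    continuous. *)

Section metric_group.
Context (R : realType) (H : topologicalZmodType) (d : H -> H -> R).
Hypotheses (dm : is_metric d) (dmz : metrizes d)
  (dinv : translation_invariant_metric d).

Lemma dist_subr x y : d x y = d 0 (y - x).
Proof. by rewrite -(dinv x y (- x)) subrr. Qed.

Lemma nbhs_dball x r : 0 < r -> nbhs x [set y | d x y < r].
Proof. by move=> r0; apply/dmz; exists r. Qed.

Lemma open_dball x r : open [set y | d x y < r].
Proof.
case: dm => _ _ ds dt; rewrite openE => y /= xy.
apply/dmz; exists (r - d x y); first by rewrite subr_gt0.
by move=> z /= yz; apply: le_lt_trans (dt x y z) _; rewrite -ltrBrDl.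
Qed.

Lemma metrizes_hausdorff : hausdorff_space H.
Proof.
case: dm => d0 de ds dt x y cl; apply/de/eqP; rewrite eq_le d0 andbT leNgt.
apply/negP => xy; have h2 : 0 < d x y / 2 by rewrite divr_gt0.
have [z [/= xz yz]] := cl _ _ (nbhs_dball x h2) (nbhs_dball y h2).
have := dt x z y; rewrite leNgt => /negP; apply.
by rewrite (splitr (d x y)) ltrD // ds.
Qed.

Lemma metrizes_compact_closed (K : set H) : compact K -> closed K.
Proof. by apply: compact_closed; exact: metrizes_hausdorff. Qed.

Lemma compact_dnet (K : set H) r : compact K -> 0 < r ->
  exists2 D : set H, finite_set D & forall x, K x -> exists2 y, D y & d y x < r.
Proof.
move=> /compact_near_coveringP cK r0.
(* The filter generated by the families of all supersets of a finite set. Near [x] it is enough that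
   [D] contains [x], and the near-covering form of compactness then yields one finite net for all of
   [K]. *)
pose F : set_system (set H) :=
  filter_from [set D | finite_set D] (fun D => [set D' | D `<=` D']).
have FF : Filter F.
  apply: filter_from_filter; first by exists set0; exact: finite_set0.
  move=> D E fD fE; exists (D `|` E); first by rewrite /= finite_setU; split.
  by move=> D' h; split => x Dx; apply: h; [left|right].
have [D fD h] : \forall D \near F, K `<=` (fun x => exists2 y, D y & d y x < r).
  apply: cK => x Kx; exists ([set y | d x y < r], [set D | D x]).
    split; first exact: nbhs_dball.
    by exists [set x]; [exact: finite_set1 | move=> D; apply].
  by case=> y D /= [xy Dx]; exists x.
by exists D => //; apply: h.
Qed.

Lemma compact_dbounded (K : set H) : compact K ->
  exists M, forall x, K x -> d 0 x <= M.
Proof.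
case: dm => _ _ _ dt /compact_near_coveringP cK.
have [M [_ hM]] : \forall M \near +oo, K `<=` (fun x => d 0 x <= M).
  apply: cK => x Kx; exists ([set y | d x y < 1], [set M | d 0 x + 1 < M]).
    by split; [exact: nbhs_dball | exists (d 0 x + 1); split => //; exact: num_real].
  case=> y M /= [xy DM]; apply: ltW; apply: le_lt_trans DM.
  by apply: le_trans (dt _ x _) _; rewrite lerD2l ltW.
by exists (M + 1); apply: hM; rewrite ltrDl.
Qed.

(** The base consists of the balls of radius 1/(m+1) centred at a finite net of [K n] of the same
    mesh, for all n and m. If 1/(m+1) < r/2, the ball around a net point close to [x] contains [x]
    and stays within distance [r] of it. *)
Lemma sigma_compact_base (K : nat -> set H) : (forall n, compact (K n)) ->
  \bigcup_n K n = setT -> @second_countable H.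
Proof.
move=> cK KT; have n0 n : 0 < n.+1%:R^-1 :> R by rewrite invr_gt0.
have /choice[D hD] (p : nat * nat) : exists D : set H, finite_set D /\
    forall x, K p.1 x -> exists2 y, D y & d y x < p.2.+1%:R^-1.
  by have [D fD h] := compact_dnet (cK p.1) (n0 p.2); exists D.
exists (\bigcup_p ((fun y => [set z | d y z < p.2.+1%:R^-1]) @` D p)); [|split].
- apply: bigcup_countable => // p _; apply: finite_set_countable.
  by apply: finite_image; case: (hD p).
- by move=> _ [p _ [y _ <-]]; exact: open_dball.
- case: dm => d0 _ ds dt x V /dmz[r r0 rV].
  have [m hm] := ltr_add_invr (y := 0) (divr_gt0 r0 (ltr0Sn R 1)).
  have : [set: H] x by []. rewrite -KT => -[n _ Kn].
  have [y Dy yx] := (hD (n, m)).2 x Kn.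
  exists [set z | d y z < m.+1%:R^-1]; first split => //.
    by exists (n, m) => //; exists y.
  move=> z /= yz; apply: rV => /=; apply: le_lt_trans (dt x y z) _.
  rewrite (splitr r) ds; rewrite add0r in hm.
  by apply: ltrD; [apply: lt_trans yx hm | apply: lt_trans yz hm].
Qed.

End metric_group.

Section borel_measurability.
Context (H : topologicalZmodType).

Lemma open_borel (U : set H) : open U -> measurable (U : set (borel H)).
Proof. exact: sub_gen_smallest. Qed.

Lemma closed_borel (U : set H) : closed U -> measurable (U : set (borel H)).
Proof.
move=> cU; rewrite -(setCK U); apply: measurableC; apply: open_borel.
exact: closed_openC.
Qed.

Lemma continuous_borel (K : topologicalZmodType) (f : H -> K) :
  continuous f -> measurable_fun [set: borel H] (f : borel H -> borel K).
Proof.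
move=> cf; apply: (@measurability _ _ (borel H) (borel K) _ _ (@open K)) => //.
move=> _ [U oU <-]; rewrite setTI; apply: open_borel.
by move/continuousP: cf; exact.
Qed.

Lemma continuous_borel_real (R : realType) (f : H -> R) :
  continuous f -> measurable_fun [set: borel H] (f : borel H -> R).
Proof.
move=> /continuousP cf; apply: (measurability _ (RGenOpens.measurableE R)).
move=> _ [_ [a [b ->] <-]]; rewrite setTI; apply: open_borel; apply: cf.
exact: interval_open.
Qed.

Hypothesis sc : @second_countable H.

(** An open set of the product is a union of boxes of basic open sets, and a countable base leaves
    only countably many boxes. Without such a base the product sigma-algebra may miss open sets, and
    subtraction may fail to be measurable for it. *)
Lemma prod_open_measurable (U : set (H * H)) : open U ->
  measurable (U : set (borel H * borel H)).
Proof.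
case: sc => B cB [oB bB] oU.
pose P := [set p : set H * set H | [/\ B p.1, B p.2 & p.1 `*` p.2 `<=` U]].
have -> : U = \bigcup_(p in P) (p.1 `*` p.2).
  apply/seteqP; split=> [[x y] Uxy|[x y] [p [_ _ pU] pxy]]; last exact: pU.
  have [[V W] /= [nV nW] VW] : nbhs (x, y) U by exact: open_nbhs_nbhs.
  have [V' [BV V'x] V'V] := bB _ _ nV; have [W' [BW W'y] W'W] := bB _ _ nW.
  exists (V', W') => //=; split => //= -[a b] [/= aV bW]; apply: VW.
  by split; [exact: V'V | exact: W'W].
have : countable P.
  apply: (sub_countable _ (countableX cB cB)).
  by apply: subset_card_le => -[V W] [].
move=> /pfcard_geP[->|[g]]; first by rewrite bigcup_set0.
rewrite -[P](image_eq g) bigcup_image; apply: bigcup_measurable => n _.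
have [BV BW _] : P (g n) by apply: (@funS _ _ _ _ g).
by apply: measurableX; apply: open_borel; exact: oB.
Qed.

Lemma continuous_borel2 (K : topologicalZmodType) (f : H * H -> K) :
  continuous f ->
  measurable_fun [set: borel H * borel H] (f : borel H * borel H -> borel K).
Proof.
move=> /continuousP cf.
apply: (@measurability _ _ (borel H * borel H)%type (borel K) _ _ (@open K)) => //.
by move=> _ [U oU <-]; rewrite setTI; apply: prod_open_measurable; exact: cf.
Qed.

End borel_measurability.

(** * Integration *)

Section iterated_integrals.
Context d (T : measurableType d) (R : realType) (mu : {measure set T -> \bar R}).
Hypothesis sf : sigma_finite setT mu.

(* A copy of [mu] carrying the sigma-finite structure, since the hypothesis
   [sf] cannot be attached to the variable [mu] itself. *)
Definition sigma_finite_alias : set T -> \bar R := let _ := sf in mu.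

HB.instance Definition _ := Measure.on sigma_finite_alias.
HB.instance Definition _ :=
  @Measure_isSigmaFinite.Build _ _ _ sigma_finite_alias sf.

Local Notation mu' := (sigma_finite_alias : {sigma_finite_measure set T -> \bar R}).

Lemma tonelli (f : T * T -> \bar R) : measurable_fun [set: T * T] f ->
  (forall p, 0 <= f p)%E ->
  (\int[mu]_x \int[mu]_y f (x, y) = \int[mu]_y \int[mu]_x f (x, y))%E.
Proof. exact: (@fubini_tonelli _ _ _ _ _ mu' mu'). Qed.

Lemma measurable_integral2 (f : T * T -> \bar R) : measurable_fun [set: T * T] f ->
  (forall p, 0 <= f p)%E ->
  measurable_fun setT (fun x => \int[mu]_y f (x, y))%E.
Proof. exact: (@measurable_fun_fubini_tonelli_F _ _ _ _ _ mu'). Qed.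

Lemma measurable_integral1 (f : T * T -> \bar R) : measurable_fun [set: T * T] f ->
  (forall p, 0 <= f p)%E ->
  measurable_fun setT (fun y => \int[mu]_x f (x, y))%E.
Proof. exact: (@measurable_fun_fubini_tonelli_G _ _ _ _ _ mu'). Qed.

End iterated_integrals.

Lemma nneseries_cvg_EFin (R : realType) (u : nat -> R) : (forall n, 0 <= u n) ->
  (\sum_(k <oo) (u k)%:E)%E \is a fin_num -> cvgn (series u).
Proof.
move=> u0 Su; have : cvgn (fun n => \sum_(0 <= k < n) (u k)%:E)%E.
  by apply: is_cvg_nneseries => n _ _; rewrite lee_fin.
move=> ul.
have {}ul : (fun n => \sum_(0 <= k < n) (u k)%:E)%E @ \oo -->
  (fine (\sum_(k <oo) (u k)%:E)%E)%:E by rewrite fineK.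
move/fine_cvgP : ul => [_ ul].
apply: cvgP; suff -> : series u = fine \o (fun n => \sum_(0 <= k < n) (u k)%:E)%E.
  exact: ul.
by apply/funext => n /=; rewrite sumEFin.
Qed.

Lemma cvge0_le (R : realType) (u : nat -> \bar R) : (forall n, 0 <= u n)%E ->
  (forall e : R, 0 < e -> exists N, forall n, (N <= n)%N -> (u n <= e%:E)%E) ->
  u n @[n --> \oo] --> 0%E.
Proof.
move=> u0 ue; apply/fine_cvgP; split.
  have [N hN] := ue _ ltr01; exists N => // n /= /hN un.
  by rewrite ge0_fin_numE// (le_lt_trans un)// ltry.
apply/cvgrPdist_le => e e0; have [N hN] := ue _ e0.
exists N => // n /= /hN un; rewrite sub0r normrN ger0_norm ?fine_ge0//.
by rewrite -lee_fin fineK// ge0_fin_numE// (le_lt_trans un)// ltry.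
Qed.

Lemma cvge0_near (R : realType) (u : nat -> \bar R) (e : R) :
  u n @[n --> \oo] --> 0%E -> 0 < e ->
  exists N, forall n, (N <= n)%N -> (u n <= e%:E)%E.
Proof.
move=> /fine_cvgP[uf /cvgrPdist_le /(_ e)] + e0 => /(_ e0) ue.
have [N _ hN] : \forall n \near \oo, u n \is a fin_num /\ `|0 - fine (u n)| <= e.
  exact: filterI uf ue.
exists N => n /hN[un]; rewrite sub0r normrN => une.
by rewrite -(fineK un) lee_fin (le_trans (ler_norm _)).
Qed.

Lemma limn_einf_le (R : realType) (u : nat -> \bar R) (l : \bar R) (N : nat) :
  (forall n, (N <= n)%N -> (u n <= l)%E) -> (limn_einf u <= l)%E.
Proof.
move=> ul; rewrite limn_einf_lim; apply: lime_le; first exact: is_cvg_einfs.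
apply: nearW => n; apply: (@le_trans _ _ (u (maxn n N))).
  by apply: ereal_inf_lbound; exists (maxn n N) => //=; exact: leq_maxl.
by apply: ul; exact: leq_maxr.
Qed.

(** * The L1 distance and its completeness *)

Section L1_distance.
Context d (T : measurableType d) (R : realType) (mu : {measure set T -> \bar R}).
Implicit Types f g h : T -> R.
Local Open Scope ereal_scope.

(** Extended-real valued, so that the triangle inequality asks for measurability only and
    integrability need not be carried along. *)
Definition L1dist f g := \int[mu]_x `|f x - g x|%:E.

Lemma L1dist_ge0 f g : 0 <= L1dist f g.
Proof. by apply: integral_ge0 => x _; rewrite lee_fin. Qed.

Lemma L1distC f g : L1dist f g = L1dist g f.
Proof. by apply: eq_integral => x _; rewrite distrC. Qed.

Lemma measurable_absB f g : measurable_fun setT f -> measurable_fun setT g ->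
  measurable_fun setT (fun x => `|f x - g x|%:E).
Proof.
by move=> mf mg; apply/measurable_EFinP/measurableT_comp => //;
  exact: measurable_funB.
Qed.

Lemma L1dist_triangle g f h :
  measurable_fun setT f -> measurable_fun setT g -> measurable_fun setT h ->
  L1dist f h <= L1dist f g + L1dist g h.
Proof.
move=> mf mg mh; rewrite -ge0_integralD//; try exact: measurable_absB.
apply: ge0_le_integral => //; try exact: measurable_absB.
  by apply: emeasurable_funD; exact: measurable_absB.
by move=> x _; rewrite -EFinD lee_fin; exact: ler_distD.
Qed.

Lemma ae_eq_L1dist f f' g g' :
  measurable_fun setT f -> measurable_fun setT f' ->
  measurable_fun setT g -> measurable_fun setT g' ->
  {ae mu, forall x, f x = f' x} -> {ae mu, forall x, g x = g' x} ->
  L1dist f g = L1dist f' g'.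
Proof.
move=> mf mf' mg mg' ff' gg'; apply: ae_eq_integral => //;
  try exact: measurable_absB.
by apply: filterS2 ff' gg' => x -> ->.
Qed.

Lemma L1dist_eq0 f g : measurable_fun setT f -> measurable_fun setT g ->
  L1dist f g = 0 -> {ae mu, forall x, f x = g x}.
Proof.
move=> mf mg fg; have := @ae_eq_integral_abs _ _ _ mu setT measurableT _
  (measurable_absB mf mg).
move=> [+ _]; under eq_integral do rewrite abse_EFin normr_id; move=> /(_ fg).
by apply: filterS => x /(_ I) [/eqP]; rewrite normr_eq0 subr_eq0 => /eqP.
Qed.

Lemma Rintegral_abs_le f : mu.-integrable setT (EFin \o f) ->
  `|\int[mu]_x f x|%:E <= \int[mu]_x `|f x|%:E.
Proof.
move=> If; rewrite EFin_normr_Rintegral//; apply: le_abse_integral => //.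
exact: measurable_int If.
Qed.

(** Riesz-Fischer. The subsequence [phi] is part of the conclusion because its almost everywhere
    convergence later transfers sign and support to the limit. *)
Lemma L1_complete (f : nat -> T -> R) :
  (forall n, measurable_fun setT (f n)) ->
  (forall e : R, (0 < e)%R -> exists N, forall m n, (N <= m)%N -> (N <= n)%N ->
     L1dist (f m) (f n) <= e%:E) ->
  exists g (phi : nat -> nat), [/\ measurable_fun setT g,
    forall n, (n <= phi n)%N,
    {ae mu, forall x, f (phi n) x @[n --> \oo] --> g x} &
    L1dist (f n) g @[n --> \oo] --> 0].
Proof.
move=> mf cf.
have e0 k : (0 < 1 / (2 ^ k.+1)%:R :> R)%R by rewrite divr_gt0 // ltr0n expn_gt0.
have [N hN] := choice (fun k => cf _ (e0 k)).
(* Large enough that successive terms of the subsequence differ by at most 2^-(k+1) in L1, and at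
   least [k], so that the subsequence goes to infinity. *)
pose phi k := (k + \sum_(i < k.+1) N i)%N.
have Nphi k j : (k <= j)%N -> (N k <= phi j)%N.
  move=> kj; rewrite /phi (bigD1 (Ordinal (kj : (k < j.+1)%N)))//=.
  by rewrite addnA addnAC addnC leq_addr.
pose D k x := `|f (phi k.+1) x - f (phi k) x|%:E.
have mD k : measurable_fun setT (D k) by exact: measurable_absB.
have D0 k x : 0 <= D k x by rewrite lee_fin.
have SD : \int[mu]_x (\sum_(k <oo) D k x) < +oo.
  rewrite integral_nneseries//.
  apply: le_lt_trans (ltry 1).
  (* The zero sequence is added to match [epsilon_trick], which bounds the whole sum by 1. *)
  apply: (@le_trans _ _ (\sum_(k <oo) (cst 0 k + (1 / (2 ^ k.+1)%:R)%:E))).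
    apply: lee_nneseries => [k _ _|k _]; first exact: integral_ge0.
    by rewrite add0e; apply: hN; exact: Nphi.
  apply: le_trans (epsilon_trick _ _ _) _ => //.
  by rewrite eseries0// add0e.
have aeS : {ae mu, forall x, (\sum_(k <oo) D k x) \is a fin_num}.
  have : mu.-integrable setT (fun x => \sum_(k <oo) D k x).
    apply/integrableP; split; first exact: ge0_emeasurable_sum.
    by under eq_integral do rewrite gee0_abs ?nneseries_ge0//.
  by move=> /(integrable_ae measurableT); apply: filterS => x; apply.
have aec : {ae mu, forall x, cvgn (fun k => f (phi k) x)}.
  apply: filterS aeS => x Sx.
  have : cvgn (series (telescope (fun k => f (phi k) x))).
    apply: normed_cvg.
    by apply: (@nneseries_cvg_EFin R
      (fun k => `|telescope (fun k => f (phi k) x) k|%R)).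
  rewrite telescopeK => /cvg_ex[l /= hl]; apply: (cvgP (l + f (phi 0%N) x)%R).
  rewrite (_ : (fun k => _) = fun k =>
    (f (phi k) x - f (phi 0%N) x + f (phi 0%N) x)%R); last first.
    by apply/funext => k; rewrite subrK.
  by apply: cvgD hl _; exact: cvg_cst.
(* An upper limit is measurable without any convergence, and it is the limit wherever the
   subsequence converges. *)
pose g x := fine (limn_esup (fun k => (f (phi k) x)%:E)).
have mg : measurable_fun setT g.
  apply: measurableT_comp; first exact: fine_measurable.
  by apply: measurable_fun_limn_esup => n; exact/measurable_EFinP.
have cg : {ae mu, forall x, f (phi n) x @[n --> \oo] --> g x}.
  apply: filterS aec => x /cvg_ex[l xl].
  suff -> : g x = l by [].
  have : (f (phi n) x)%:E @[n --> \oo] --> l%:E.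
    by apply: cvg_EFin => //; exact: nearW.
  by move=> /cvg_limn_einf_sup[_ h]; rewrite /g h.
exists g, phi; split => //; first by move=> n; exact: leq_addr.
apply: cvge0_le => [n|e /cf[M hM]]; first exact: L1dist_ge0.
exists M => n Mn.
(* Writing the distance to [g] as the integral of a lower limit along [phi] lets Fatou's lemma carry
   the Cauchy bound over to the limit. *)
have -> : L1dist (f n) g =
    \int[mu]_x limn_einf (fun k => `|f n x - f (phi k) x|%:E).
  apply: ae_eq_integral => //; first exact: measurable_absB.
    rewrite (_ : (fun x => _) = fun x =>
        - limn_esup (fun k => - `|f n x - f (phi k) x|%:E)); last first.
      apply/funext => x; rewrite -limn_einfN; congr limn_einf.
      by apply/funext => k; rewrite /comp oppeK.
    apply: measurableT_comp => //; apply: measurable_fun_limn_esup => k.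
    by apply: measurableT_comp => //; exact: measurable_absB.
  apply: filterS cg => x xg _.
  have /cvg_limn_einf_sup[-> _//] :
    `|f n x - f (phi k) x|%:E @[k --> \oo] --> `|f n x - g x|%:E.
  apply: cvg_EFin; first exact: nearW.
  by apply: cvg_norm; apply: cvgB => //; exact: cvg_cst.
apply: le_trans (fatou _ _ _ _) _ => //.
  by move=> k; exact: measurable_absB.
apply: (@limn_einf_le _ _ _ M) => k Mk; apply: hM => //.
by rewrite (leq_trans Mk)// leq_addr.
Qed.
End L1_distance.

(** * Haar measure and convolution *)

Lemma shift_continuous (H : topologicalZmodType) (v : H) :
  continuous (fun x : H => x - v).
Proof.
move=> x.
apply: (@continuous_comp _ _ _ (fun x => (x, v)) (fun p : H * H => p.1 - p.2)).
  by apply: cvg_pair; [exact: cvg_id | exact: cvg_cst].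
exact: sub_continuous.
Qed.

Section haar.
Context (R : realType) (H : topologicalZmodType)
  (theta : {measure set (borel H) -> \bar R}).
Hypotheses (sc : @second_countable H) (sf : sigma_finite setT theta)
  (thH : is_haar theta).
Local Open Scope ereal_scope.
Implicit Types f g h : borel H -> \bar R.

Local Notation subm := (fun x y : borel H => (x : H) - (y : H) : borel H)%R.

Lemma measurable_shift (v : H) :
  measurable_fun setT (fun x : borel H => ((x : H) - v)%R : borel H).
Proof. by apply: continuous_borel; exact: shift_continuous. Qed.

Lemma measurable_shiftD (v : H) :
  measurable_fun setT (fun x : borel H => ((x : H) + v)%R : borel H).
Proof. by have := measurable_shift (- v)%R; rewrite opprK. Qed.

Lemma measurable_opp :
  measurable_fun setT (fun x : borel H => (- (x : H))%R : borel H).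
Proof. by apply: continuous_borel; exact: opp_continuous. Qed.

Lemma measurable_subC (v : H) :
  measurable_fun setT (fun x : borel H => (v - (x : H))%R : borel H).
Proof.
rewrite (_ : (fun x => _) = fun x : borel H => (- ((x : H) - v))%R : borel H).
  exact: (measurableT_comp measurable_opp (measurable_shift v)).
by apply/funext => x; rewrite opprB.
Qed.

Lemma measurable_sub2 : measurable_fun [set: borel H * borel H]
  (fun p => ((p.1 : H) - (p.2 : H))%R : borel H).
Proof. exact: (continuous_borel2 sc (@sub_continuous H)). Qed.

Lemma measurable_sub2C : measurable_fun [set: borel H * borel H]
  (fun p => ((p.2 : H) - (p.1 : H))%R : borel H).
Proof.
exact: (measurableT_comp measurable_sub2 (@measurable_swap _ _ (borel H) (borel H))).
Qed.

Lemma measurable_add2 : measurable_fun [set: borel H * borel H]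
  (fun p => ((p.1 : H) + (p.2 : H))%R : borel H).
Proof. exact: (continuous_borel2 sc (@add_continuous H)). Qed.

Lemma haar_shift (v : H) (B : set (borel H)) : measurable B ->
  theta ((fun x : H => x - v)%R @^-1` B) = theta B.
Proof.
move=> mB; rewrite -(haar_translation thH v mB); congr (theta _).
apply/seteqP; split => [x Bx|x [b Bb <-]] /=; last by rewrite addrC addKr.
by exists (x - v)%R => //; rewrite addrC subrK.
Qed.

Lemma ge0_integral_shift f (v : H) : measurable_fun setT f ->
  (forall x, 0 <= f x) ->
  \int[theta]_x f ((x : H) - v)%R = \int[theta]_x f x.
Proof.
move=> mf f0.
have := @ge0_integral_pushforward _ _ _ _ R _ (measurable_shift v) theta
  setT f measurableT mf (fun x _ => f0 x).
rewrite preimage_setT => <-; apply: eq_measure_integral.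
  exact: measurable_shift.
by move=> mv B mB _; exact: haar_shift.
Qed.

(* For [B] of finite positive measure, the integrals over [H x H] of
   [1_B(x) f(y - x)] and [1_B(x + y) f(- x)] agree by translation invariance;
   they are [theta B] times the two sides. No uniqueness of Haar measure is needed. *)
Lemma ge0_integral_opp f : measurable_fun setT f -> (forall x, 0 <= f x) ->
  \int[theta]_x f (- (x : H))%R = \int[theta]_x f x.
Proof.
move=> mf f0.
have [B [mB B0 Boo]] : exists B : set (borel H),
    [/\ measurable B, 0 < theta B & theta B < +oo].
  have [F TF hF] := sf; apply: contrapT => /forallNP nB.
  have : theta.-negligible [set: borel H].
    rewrite TF; apply: negligible_bigcup => i; have [mF Foo] := hF i.
    apply/negligibleP => //; apply/eqP; rewrite eq_le measure_ge0 andbT leNgt.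
    by apply/negP => F0; apply: (nB (F i)).
  move/negligibleP => /(_ measurableT) T0.
  by have := haar_neq0 thH; rewrite T0 ltxx.
have mb : measurable_fun setT (fun x => (\1_B x)%:E : \bar R).
  by apply/measurable_EFinP; exact: measurable_indic.
have b0 x : 0 <= (\1_B x)%:E :> \bar R by rewrite lee_fin.
suff : theta B * \int[theta]_x f x = theta B * \int[theta]_x f (- (x : H))%R.
  have Bf : theta B \is a fin_num by rewrite ge0_fin_numE// ltW.
  have B1 : (fine (theta B))^-1%:E * theta B = 1.
    by rewrite -{2}(fineK Bf) -EFinM mulVf// fine_eq0// gt_eqF.
  by move=> /(congr1 (fun z => (fine (theta B))^-1%:E * z)); rewrite !muleA B1 !mul1e.
have iB : \int[theta]_x (\1_B x)%:E = theta B.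
  by rewrite integral_indic// setIT.
rewrite -iB.
have mf' := measurableT_comp mf measurable_opp.
transitivity (\int[theta]_x \int[theta]_y ((\1_B x)%:E * f (subm y x))).
  rewrite -ge0_integralZr//; last exact: integral_ge0.
  apply: eq_integral => x _; rewrite ge0_integralZl// ?ge0_integral_shift//.
  exact: (measurableT_comp mf (measurable_shift x)).
rewrite (@tonelli _ _ _ _ sf (fun p => (\1_B p.1)%:E * f (subm p.2 p.1))); last 2 first.
- apply: emeasurable_funM; first exact: (measurableT_comp mb measurable_fst).
  exact: (measurableT_comp mf measurable_sub2C).
- by move=> p; exact: mule_ge0.
transitivity (\int[theta]_y \int[theta]_x ((\1_B (x + y)%R)%:E * f (- (x : H))%R)).
  apply: eq_integral => y _.
  pose F (x : borel H) := (\1_B ((x : H) + y)%R)%:E * f (- (x : H))%R.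
  have mF : measurable_fun setT F.
    apply: emeasurable_funM => //.
    exact: (measurableT_comp mb (measurable_shiftD y)).
  have F0 x : 0 <= F x by exact: mule_ge0.
  rewrite -[RHS](ge0_integral_shift y mF F0); apply: eq_integral => x _.
  by rewrite /F subrK opprB.
rewrite -(@tonelli _ _ _ _ sf
  (fun p => (\1_B ((p.1 : H) + p.2)%R)%:E * f (- (p.1 : H))%R)); last 2 first.
- apply: emeasurable_funM; first exact: (measurableT_comp mb measurable_add2).
  exact: (measurableT_comp mf' measurable_fst).
- by move=> p; exact: mule_ge0.
rewrite -ge0_integralZl//; last exact: integral_ge0.
apply: eq_integral => x _ /=.
have mbx : measurable_fun setT (fun y : borel H => (\1_B ((x : H) + y)%R)%:E : \bar R).
  rewrite (_ : (fun y => _) = fun y : borel H => (\1_B ((y : H) + x)%R)%:E).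
    exact: (measurableT_comp mb (measurable_shiftD x)).
  by apply/funext => y; rewrite addrC.
rewrite ge0_integralZr//; congr (_ * _).
rewrite -[RHS](ge0_integral_shift (- x)%R)//.
by apply: eq_integral => y _; rewrite opprK addrC.
Qed.

Lemma ge0_integral_subC f (v : H) : measurable_fun setT f ->
  (forall x, 0 <= f x) ->
  \int[theta]_x f (v - (x : H))%R = \int[theta]_x f x.
Proof.
move=> mf f0; rewrite -[RHS](ge0_integral_opp mf f0).
rewrite -[RHS](@ge0_integral_shift (fun x => f (- (x : H))%R) v)//.
  by apply: eq_integral => x _; rewrite opprB.
exact: (measurableT_comp mf measurable_opp).
Qed.

(** A null set stays null under v - x by [ge0_integral_subC] applied to its indicator. This is what
    makes the value of a convolution at each single point independent of the representatives. *)
Lemma ae_subC (P : borel H -> Prop) (v : H) : {ae theta, forall x, P x} ->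
  {ae theta, forall x : borel H, P (v - (x : H))%R}.
Proof.
move=> [N [mN N0 PN]]; exists ((fun x : H => v - x)%R @^-1` N); split.
- by rewrite -[X in measurable X]setTI; exact: measurable_subC.
- have m1 : measurable_fun setT (fun x => (\1_N x)%:E : \bar R).
    by apply/measurable_EFinP; exact: measurable_indic.
  have m2 : measurable ((fun x : H => v - x)%R @^-1` N : set (borel H)).
    by rewrite -[X in measurable X]setTI; exact: measurable_subC.
  rewrite -[LHS](congr1 theta (setIT _)) -integral_indic//.
  rewrite -[RHS]N0 -[in RHS](setIT N) -[RHS]integral_indic//.
  by apply: (ge0_integral_subC v m1) => x; rewrite lee_fin.
- by move=> x /= Px; apply: PN.
Qed.

(** The extended-real convolution: for non-negative measurable functions its algebraic identities
    hold at every point, with no finiteness condition. The real [convol] is its [fine] value, and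
    agrees with it almost everywhere for densities. *)
Definition econvol f g x := \int[theta]_v (f (subm x v) * g v).

Section econvol.
Variables f g h : borel H -> \bar R.
Hypotheses (mf : measurable_fun setT f) (mg : measurable_fun setT g)
  (mh : measurable_fun setT h) (f0 : forall x, 0 <= f x)
  (g0 : forall x, 0 <= g x) (h0 : forall x, 0 <= h x).

Lemma measurable_econvol_integrand :
  measurable_fun [set: borel H * borel H] (fun p => f (subm p.1 p.2) * g p.2).
Proof.
apply: emeasurable_funM; first exact: (measurableT_comp mf measurable_sub2).
exact: (measurableT_comp mg measurable_snd).
Qed.

Lemma measurable_econvol_integrandl x :
  measurable_fun setT (fun v => f (subm x v) * g v).
Proof.
by apply: emeasurable_funM => //; exact: (measurableT_comp mf (measurable_subC x)).
Qed.

Lemma econvol_ge0 x : 0 <= econvol f g x.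
Proof. by apply: integral_ge0 => v _; exact: mule_ge0. Qed.

Lemma measurable_econvol : measurable_fun setT (econvol f g).
Proof.
apply: (measurable_integral2 sf measurable_econvol_integrand).
by move=> p; exact: mule_ge0.
Qed.

Lemma integral_econvol :
  \int[theta]_x econvol f g x = \int[theta]_x f x * \int[theta]_x g x.
Proof.
rewrite /econvol (tonelli sf measurable_econvol_integrand); last first.
  by move=> p; exact: mule_ge0.
rewrite -ge0_integralZl//; last exact: integral_ge0.
apply: eq_integral => v _ /=; rewrite ge0_integralZr//.
  by rewrite ge0_integral_shift.
exact: (measurableT_comp mf (measurable_shift v)).
Qed.

End econvol.

Lemma econvolC f g x : measurable_fun setT f -> measurable_fun setT g ->
  (forall x, 0 <= f x) -> (forall x, 0 <= g x) -> econvol f g x = econvol g f x.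
Proof.
move=> mf mg f0 g0; rewrite /econvol.
rewrite -[RHS](@ge0_integral_subC (fun v => g (subm x v) * f v) x).
- by apply: eq_integral => v _ /=; rewrite subKr muleC.
- exact: measurable_econvol_integrandl.
- by move=> v; exact: mule_ge0.
Qed.

Lemma econvolA f g h x : measurable_fun setT f -> measurable_fun setT g ->
  measurable_fun setT h -> (forall x, 0 <= f x) -> (forall x, 0 <= g x) ->
  (forall x, 0 <= h x) -> econvol (econvol f g) h x = econvol f (econvol g h) x.
Proof.
move=> mf mg mh f0 g0 h0; rewrite /econvol.
transitivity (\int[theta]_v \int[theta]_w (f (subm x w) * g (subm w v) * h v)).
  apply: eq_integral => v _; rewrite ge0_integralZr//; last 2 first.
  - apply: emeasurable_funM; first exact: (measurableT_comp mf (measurable_subC x)).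
    exact: (measurableT_comp mg (measurable_shift v)).
  - by move=> w _; exact: mule_ge0.
  congr (_ * _).
  (* The substitution w = u + v in the inner integral, after which Tonelli exchanges v and w. *)
  rewrite -[LHS](@ge0_integral_shift (fun u => f (subm (subm x v) u) * g u) v).
  - apply: eq_integral => u _ /=.
    have -> // : ((x : H) - v - ((u : H) - v) = (x : H) - u)%R.
    by rewrite opprB addrA subrK.
  - exact: measurable_econvol_integrandl.
  - by move=> u; exact: mule_ge0.
rewrite (@tonelli _ _ _ _ sf (fun p => f (subm x p.2) * g (subm p.2 p.1) * h p.1)).
- apply: eq_integral => w _ /=; rewrite -ge0_integralZl//.
  + by apply: eq_integral => v _; rewrite muleA.
  + exact: measurable_econvol_integrandl.
  + by move=> v _; exact: mule_ge0.
- apply: emeasurable_funM; last exact: (measurableT_comp mh measurable_fst).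
  apply: emeasurable_funM.
    exact: (measurableT_comp (measurableT_comp mf (measurable_subC x)) measurable_snd).
  exact: (measurableT_comp mg measurable_sub2C).
- by move=> p; rewrite !mule_ge0.
Qed.

End haar.

(** * Probability densities, their convolution and their dilation *)

Section density.
Context (R : realType) (H : topologicalZmodType)
  (theta : {measure set (borel H) -> \bar R}).
Hypotheses (sc : @second_countable H) (sf : sigma_finite setT theta)
  (thH : is_haar theta).
Implicit Types f g h : borel H -> R.

(** Non-negativity is required everywhere so that Tonelli applies without exceptional sets;
    [probability_density] provides such a representative of [h]. *)
Definition density f := [/\ measurable_fun setT f, forall x, 0 <= f x &
  (\int[theta]_x (f x)%:E = 1)%E].

Lemma density_integrable f : density f -> theta.-integrable setT (EFin \o f).
Proof.
case=> mf f0 f1; apply/integrableP; split; first exact/measurable_EFinP.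
under eq_integral do rewrite abse_EFin ger0_norm//.
by rewrite f1 ltry.
Qed.

Section two.
Variables f g : borel H -> R.
Hypotheses (df : density f) (dg : density g).

Let mf : measurable_fun setT (EFin \o f).
Proof. by case: df => ? _ _; exact/measurable_EFinP. Qed.
Let mg : measurable_fun setT (EFin \o g).
Proof. by case: dg => ? _ _; exact/measurable_EFinP. Qed.
Let f0 x : (0 <= (EFin \o f) x)%E. Proof. by case: df => _ ? _; rewrite lee_fin. Qed.
Let g0 x : (0 <= (EFin \o g) x)%E. Proof. by case: dg => _ ? _; rewrite lee_fin. Qed.

Lemma convolE x : convol theta f g x =
  fine (econvol theta (EFin \o f) (EFin \o g) x).
Proof. by []. Qed.

Lemma econvol_fin_num :
  {ae theta, forall x, econvol theta (EFin \o f) (EFin \o g) x \is a fin_num}.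
Proof.
have mc := measurable_econvol sc sf mf mg f0 g0.
have : theta.-integrable setT (econvol theta (EFin \o f) (EFin \o g)).
  apply/integrableP; split => //.
  rewrite (eq_integral (econvol theta (EFin \o f) (EFin \o g))); last first.
    by move=> x _; rewrite gee0_abs// econvol_ge0.
  rewrite (integral_econvol sc sf thH mf mg f0 g0).
  by case: df => _ _ /= ->; case: dg => _ _ /= ->; rewrite mul1e ltry.
by move=> /(integrable_ae measurableT); apply: filterS => x; apply.
Qed.

Lemma ae_convolE : {ae theta, forall x, (convol theta f g x)%:E =
  econvol theta (EFin \o f) (EFin \o g) x}.
Proof. by apply: filterS econvol_fin_num => x; rewrite convolE => /fineK. Qed.

Lemma density_convol : density (convol theta f g).
Proof.
have mc := measurable_econvol sc sf mf mg f0 g0.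
split.
- by apply: measurableT_comp; first exact: fine_measurable.
- by move=> x; rewrite convolE fine_ge0// econvol_ge0.
- have -> : (\int[theta]_x (convol theta f g x)%:E =
      \int[theta]_x econvol theta (EFin \o f) (EFin \o g) x)%E.
    apply: ae_eq_integral => //; last by apply: filterS ae_convolE => x + _.
    by apply/measurable_EFinP/measurableT_comp; first exact: fine_measurable.
  rewrite (integral_econvol sc sf thH mf mg f0 g0).
  by case: df => _ _ /= ->; case: dg => _ _ /= ->; rewrite mul1e.
Qed.

Lemma convolC : convol theta f g = convol theta g f.
Proof. by apply/funext => x; rewrite !convolE econvolC. Qed.

End two.

(** The equality holds at every [x], since for each [x] separately v |-> x - v pulls null sets back
    to null sets. Hence [convol_ae] is an equality of functions, and representatives may be
    exchanged inside a longer convolution. *)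
Lemma econvol_ae (f f' g g' : borel H -> \bar R) x :
  measurable_fun setT f -> measurable_fun setT f' ->
  measurable_fun setT g -> measurable_fun setT g' ->
  {ae theta, forall x, f x = f' x} -> {ae theta, forall x, g x = g' x} ->
  econvol theta f g x = econvol theta f' g' x.
Proof.
move=> mf mf' mg mg' /(ae_subC sc sf thH x) ff' gg'.
apply: ae_eq_integral => //; try exact: measurable_econvol_integrandl.
by apply: filterS2 ff' gg' => v /= -> ->.
Qed.

Lemma convol_ae f f' g g' :
  measurable_fun setT f -> measurable_fun setT f' ->
  measurable_fun setT g -> measurable_fun setT g' ->
  {ae theta, forall x, f x = f' x} -> {ae theta, forall x, g x = g' x} ->
  convol theta f g = convol theta f' g'.
Proof.
move=> mf mf' mg mg' ff' gg'; apply/funext => x; congr fine.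
apply: (@econvol_ae (EFin \o f) (EFin \o f') (EFin \o g) (EFin \o g')).
- exact/measurable_EFinP.
- exact/measurable_EFinP.
- exact/measurable_EFinP.
- exact/measurable_EFinP.
- by apply: filterS ff' => v /= ->.
- by apply: filterS gg' => v /= ->.
Qed.

(** The inner [convol] differs from [econvol] only on a null set, which the outer integral does not
    see; so [econvolA] passes to the real functions at every point. *)
Lemma convolA f g h : density f -> density g -> density h ->
  convol theta (convol theta f g) h = convol theta f (convol theta g h).
Proof.
move=> df dg dh; apply/funext => x.
have [mf f0 _] := df; have [mg g0 _] := dg; have [mh h0 _] := dh.
have [mfg _ _] := density_convol df dg; have [mgh _ _] := density_convol dg dh.
move: mf mg mh mfg mgh => /measurable_EFinP mf /measurable_EFinP mg
  /measurable_EFinP mh /measurable_EFinP mfg /measurable_EFinP mgh.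
rewrite !convolE; congr fine.
rewrite (@econvol_ae _ (econvol theta (EFin \o f) (EFin \o g)) _ (EFin \o h))//;
  [|exact: measurable_econvol|exact: ae_convolE|exact: aeW].
rewrite [RHS](@econvol_ae _ (EFin \o f) _ (econvol theta (EFin \o g) (EFin \o h)))//;
  [|exact: measurable_econvol|exact: aeW|exact: ae_convolE].
by rewrite econvolA.
Qed.

Section dilation.
Variables (A Ai : H -> H) (alpha : R).
Hypotheses (AA : topgroup_automorphism A Ai) (Aa : is_modulus theta A alpha).

(** The operator T of the overview: when [Ai] is the inverse of [A] and [alpha] its modulus, this is
    the density of the image under [A] of the measure with density [f]. *)
Definition dilate f : borel H -> R := fun x => alpha * f (Ai x).

Lemma automorphism_inv : {morph Ai : x y / x + y}.
Proof.
case: AA => AD AK AiK _ _ x y; apply: (can_inj AK).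
by rewrite AD !AiK.
Qed.

Lemma automorphism_invB : {morph Ai : x y / x - y}.
Proof.
move=> x y; apply: (@addIr _ (Ai y)).
by rewrite -automorphism_inv !subrK.
Qed.

Lemma measurable_automorphism : measurable_fun setT (A : borel H -> borel H).
Proof. by case: AA => _ _ _ cA _; exact: continuous_borel. Qed.

Lemma measurable_automorphism_inv : measurable_fun setT (Ai : borel H -> borel H).
Proof. by case: AA => _ _ _ _ cA; exact: continuous_borel. Qed.

Lemma ge0_integral_automorphism (f : borel H -> \bar R) : measurable_fun setT f ->
  (forall x, 0 <= f x)%E ->
  (\int[theta]_x f (A x) = alpha%:E * \int[theta]_x f x)%E.
Proof.
case: Aa => a0 ha mf f0.
have := @ge0_integral_pushforward _ _ _ _ R _ measurable_automorphism theta
  setT f measurableT mf (fun x _ => f0 x).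
rewrite preimage_setT => <-.
have an : 0 <= alpha by exact: ltW.
have := @ge0_integral_mscale _ _ R theta setT measurableT (NngNum an) f mf (fun x _ => f0 x).
move=> /= <-; apply: eq_measure_integral; first exact: measurable_automorphism.
by move=> mA B mB _; exact: ha.
Qed.

Lemma ge0_integral_automorphism_inv (f : borel H -> \bar R) : measurable_fun setT f ->
  (forall x, 0 <= f x)%E ->
  (alpha%:E * \int[theta]_x f (Ai x) = \int[theta]_x f x)%E.
Proof.
move=> mf f0; rewrite -(@ge0_integral_automorphism (fun x => f (Ai x)))//.
  by apply: eq_integral => x _; case: AA => _ ->.
exact: (measurableT_comp mf measurable_automorphism_inv).
Qed.

(** [is_modulus] speaks of preimages under [A]. Applied to the preimage of a null set [N] under
    [Ai], it gives 0 = theta(N) = alpha theta(Ai^-1 N), and [alpha] is positive. *)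
Lemma ae_automorphism_inv (P : borel H -> Prop) : {ae theta, forall x, P x} ->
  {ae theta, forall x : borel H, P (Ai x)}.
Proof.
case: AA => _ AK AiK _ _; case: Aa => a0 ha.
move=> [N [mN N0 PN]]; have mAN : measurable (Ai @^-1` N : set (borel H)).
  by rewrite -[X in measurable X]setTI; exact: measurable_automorphism_inv.
exists (Ai @^-1` N); split => //; last by move=> x /= Px; apply: PN.
have := ha _ mAN; rewrite -comp_preimage.
have -> : Ai \o A = id by apply/funext => x /=; rewrite AK.
rewrite preimage_id N0 => /esym/eqP; rewrite mule_eq0 eqe gt_eqF//=.
by move=> /eqP.
Qed.

Lemma measurable_dilate f : measurable_fun setT f -> measurable_fun setT (dilate f).
Proof.
by move=> mf; apply: measurable_funM => //; exact: (measurableT_comp mf measurable_automorphism_inv).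
Qed.

Lemma density_dilate f : density f -> density (dilate f).
Proof.
case=> mf f0 f1; have [a0 _] := Aa; split; first exact: measurable_dilate.
  by move=> x; rewrite mulr_ge0// ltW.
under eq_integral do rewrite EFinM.
have mf' : measurable_fun setT (EFin \o f) by exact/measurable_EFinP.
rewrite ge0_integralZl//=.
- by rewrite (@ge0_integral_automorphism_inv (EFin \o f))//= => x; rewrite lee_fin.
- exact: (measurableT_comp mf' measurable_automorphism_inv).
- by move=> x _; rewrite lee_fin.
- by rewrite lee_fin ltW.
Qed.

Lemma convol_dilate f g : density f -> density g ->
  convol theta (dilate f) (dilate g) = dilate (convol theta f g).
Proof.
move=> df dg; have [mf f0 _] := df; have [mg g0 _] := dg; have [a0 _] := Aa.
apply/funext => x; rewrite /dilate /convol /Rintegral.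
pose F (v : borel H) := (f (Ai x - (v : H)) * g v)%:E.
have mF : measurable_fun setT F.
  apply/measurable_EFinP/measurable_funM => //.
  exact: (measurableT_comp mf (measurable_subC (Ai x))).
have F0 v : (0 <= F v)%E by rewrite lee_fin mulr_ge0.
have -> : (\int[theta]_v (alpha * f (Ai (x - (v : H))) * (alpha * g (Ai v)))%:E =
    alpha%:E * \int[theta]_x F x)%E.
  have mFA : measurable_fun setT (fun v : borel H => F (Ai v)).
    exact: (measurableT_comp mF measurable_automorphism_inv).
  have an : (0 <= alpha%:E)%E by rewrite lee_fin ltW.
  rewrite -(ge0_integral_automorphism_inv mF F0) -ge0_integralZl// -ge0_integralZl//; last 2 first.
  - exact: measurable_funeM.
  - by move=> v _; rewrite mule_ge0.
  by apply: eq_integral => v _; rewrite /F -!EFinM automorphism_invB mulrACA !mulrA.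
rewrite [X in alpha * fine X](_ : _ = \int[theta]_x F x)%E//.
have : (0 <= \int[theta]_x F x)%E by exact: integral_ge0.
(* If the integral is infinite, so is its multiple by [alpha], and [fine] makes both sides 0. *)
case: (\int[theta]_x F x)%E => [r _|_|//]; first by rewrite -EFinM.
by rewrite gt0_muley ?lte_fin//= mulr0.
Qed.

Lemma rescaled_iter f l : rescaled Ai alpha f l = iter l dilate f.
Proof.
elim: l => [|l ih]; first by apply/funext => x; rewrite /rescaled expr0 mul1r.
rewrite iterS -ih; apply/funext => x.
by rewrite /rescaled /dilate exprS mulrA iterSr.
Qed.

End dilation.
End density.

(** * Continuity of translations in L1 *)

Section translation.
Context (R : realType) (H : topologicalZmodType)
  (theta : {measure set (borel H) -> \bar R}).
Hypotheses (sc : @second_countable H) (sf : sigma_finite setT theta)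
  (thH : is_haar theta) (hH : hausdorff_space H).
Implicit Types f g h : borel H -> R.

Definition translate (v : H) f : borel H -> R := fun x => f ((x : H) - v).

Lemma measurable_translate v f : measurable_fun setT f ->
  measurable_fun setT (translate v f).
Proof. by move=> mf; exact: (measurableT_comp mf (measurable_shift v)). Qed.

Lemma L1dist_translate v f g : measurable_fun setT f -> measurable_fun setT g ->
  L1dist theta (translate v f) (translate v g) = L1dist theta f g.
Proof.
move=> mf mg.
apply: (@ge0_integral_shift _ _ _ thH (fun x => `|f x - g x|%:E) v).
  exact: measurable_absB.
by move=> x; rewrite lee_fin.
Qed.

Definition translation_continuous f := forall e : R, 0 < e ->
  \forall v \near (0 : H), (L1dist theta (translate v f) f <= e%:E)%E.

Lemma L1dist_indic (B C : set (borel H)) : measurable B -> measurable C ->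
  B `<=` C -> L1dist theta (\1_B) (\1_C) = theta (C `\` B).
Proof.
move=> mB mC BC; rewrite -[RHS](congr1 theta (setIT _)) -integral_indic//; last first.
  exact: measurableD.
apply: eq_integral => x _; congr EFin; rewrite !indicE in_setD.
have [xB|] := boolP (x \in B); last first.
  by rewrite sub0r normrN andbT; case: (x \in C); rewrite ?normr1 ?normr0.
by rewrite (mem_set (BC _ (set_mem xB))) subrr normr0.
Qed.

(* With [K `<=` U] compact and open approximations of [B], also [K + v `<=` U]
   for small [v]; all of [B], [K], [U] and [K + v] are then close in L1. *)
Lemma translation_continuous_indic (B : set (borel H)) : measurable B ->
  (theta B < +oo)%E -> translation_continuous (\1_B).
Proof.
move=> mB Boo e e0; have e4 : 0 < e / 4 by rewrite divr_gt0.
have Bf : theta B \is a fin_num by rewrite ge0_fin_numE.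
have [U [oU BU] UB] : exists2 U : set H, open U /\ B `<=` U &
    (theta U <= theta B + (e / 4)%:E)%E.
  have := haar_outer_regular thH mB; set S := (X in ereal_inf X) => BS.
  have Sf : ereal_inf S \is a fin_num by rewrite -BS.
  have [_ [U [oU BU] <-] h] := lb_ereal_inf_adherent e4 Sf.
  by exists U => //; rewrite BS ltW.
have Uoo : (theta U < +oo)%E.
  by rewrite (le_lt_trans UB)// -(fineK Bf) -EFinD ltry.
have Uf : theta U \is a fin_num by rewrite ge0_fin_numE.
have mU : measurable (U : set (borel H)) by exact: open_borel.
have [K [cK KU] UK] : exists2 K : set H, compact K /\ K `<=` U &
    (theta U <= theta K + (e / 4)%:E)%E.
  have := haar_inner_regular thH oU; set S := (X in ereal_sup X) => US.
  have Sf : ereal_sup S \is a fin_num by rewrite -US.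
  have [_ [K [cK KU] <-] h] := ub_ereal_sup_adherent e4 Sf.
  by exists K => //; rewrite US -leeBlDr// ltW.
have mK : measurable (K : set (borel H)).
  by apply: closed_borel; exact: compact_closed.
have Kf : theta K \is a fin_num by rewrite ge0_fin_numE// (haar_compact thH).
have KUv : \forall v \near (0 : H), K `<=` (fun x => U (x + v)).
  move/compact_near_coveringP : cK; apply => x Kx.
  have : nbhs (x + 0) U by rewrite addr0; apply: open_nbhs_nbhs; split => //; exact: KU.
  exact: (@add_continuous H (x, 0)).
have dBU : (L1dist theta (\1_B) (\1_U) <= (e / 4)%:E)%E.
  rewrite L1dist_indic// measureD// setIidr// leeBlDl//.
have dKU : (L1dist theta (\1_K) (\1_U) <= (e / 4)%:E)%E.
  rewrite L1dist_indic// measureD// setIidr// leeBlDl//.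
near=> v.
have mKv : measurable ((fun x : H => x - v) @^-1` K : set (borel H)).
  by rewrite -[X in measurable X]setTI; exact: measurable_shift.
have dKv : (L1dist theta (translate v \1_K) (\1_U) <= (e / 4)%:E)%E.
  have -> : translate v \1_K = \1_((fun x : H => x - v) @^-1` K) by [].
  have KvU : (fun x : H => x - v) @^-1` K `<=` U.
    have KU' : K `<=` (fun x => U (x + v)) by near: v.
    by move=> x /= /KU'; rewrite subrK.
  rewrite L1dist_indic// measureD// setIidr//.
  by rewrite [X in (_ - X)%E](haar_shift thH v mK) leeBlDl.
(* One quarter for each leg of the path from the translate of [B] to the translate of [K] (two legs
   through [U], translated back), then to [U], then to [B]. *)
have -> : e = e / 4 + e / 4 + (e / 4 + e / 4).
  by field.
have mi (C : set (borel H)) : measurable C -> measurable_fun setT (\1_C : borel H -> R).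
  by move=> mC; exact: measurable_indic.
apply: (@le_trans _ _ (L1dist theta (translate v \1_B) (translate v \1_K) +
    L1dist theta (translate v \1_K) (\1_B))%E).
  by apply: L1dist_triangle; rewrite ?mi//; apply: measurable_translate; exact: mi.
rewrite !EFinD; apply: leeD.
  rewrite L1dist_translate; [|exact: mi|exact: mi].
  apply: le_trans (@L1dist_triangle _ _ _ theta (\1_U : borel H -> R) _ _ _ _ _) _; rewrite ?mi//.
  by rewrite leeD// L1distC.
apply: le_trans (@L1dist_triangle _ _ _ theta (\1_U : borel H -> R) _ _ _ _ _) _; rewrite ?mi//.
  by apply: measurable_translate; exact: mi.
by rewrite leeD// L1distC.
Unshelve. all: by end_near. Qed.

Lemma translation_continuous0 : translation_continuous (cst 0).
Proof.
move=> e e0; apply: nearW => v; rewrite /L1dist.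
under eq_integral do rewrite subrr normr0.
by rewrite integral0 lee_fin ltW.
Qed.

Lemma translation_continuousD f g : measurable_fun setT f ->
  measurable_fun setT g -> translation_continuous f ->
  translation_continuous g -> translation_continuous (fun x => f x + g x).
Proof.
move=> mf mg tf tg e e0; have e2 : 0 < e / 2 by rewrite divr_gt0.
apply: filterS2 (tf _ e2) (tg _ e2) => v fe ge.
rewrite (splitr e) EFinD; apply: le_trans (leeD fe ge).
rewrite -ge0_integralD//; try by apply: measurable_absB => //; exact: measurable_translate.
apply: ge0_le_integral => //.
- apply: measurable_absB; last exact: measurable_funD.
  by apply: measurable_translate; exact: measurable_funD.
- by apply: emeasurable_funD; apply: measurable_absB => //; exact: measurable_translate.
- by move=> x _; rewrite -EFinD lee_fin /translate opprD addrACA ler_normD.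
Qed.

Lemma translation_continuousZ f (c : R) : measurable_fun setT f ->
  translation_continuous f -> translation_continuous (fun x => c * f x).
Proof.
move=> mf tf e e0.
have ec : 0 < e / (`|c| + 1) by rewrite divr_gt0// ltr_pwDr.
apply: filterS (tf _ ec) => v fe.
have -> : L1dist theta (translate v (fun x => c * f x)) (fun x => c * f x) =
    (`|c|%:E * L1dist theta (translate v f) f)%E.
  rewrite -ge0_integralZl//; last first.
    by apply: measurable_absB => //; exact: measurable_translate.
  by apply: eq_integral => x _; rewrite /translate -mulrBr normrM EFinM.
apply: (@le_trans _ _ (`|c|%:E * (e / (`|c| + 1))%:E)%E); first by rewrite lee_wpmul2l.
rewrite -EFinM lee_fin mulrCA; apply: ler_piMr; first exact: ltW.
by rewrite ler_pdivrMr ?mul1r ?lerDl// ltr_pwDr.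
Qed.

Lemma translation_continuous_sum (I : Type) (s : seq I) (F : I -> borel H -> R) :
  (forall i, measurable_fun setT (F i)) ->
  (forall i, translation_continuous (F i)) ->
  translation_continuous (fun x => \sum_(i <- s) F i x).
Proof.
move=> mF tF; elim: s => [|i s ih].
  by under [X in translation_continuous X]eq_fun do rewrite big_nil;
    exact: translation_continuous0.
under [X in translation_continuous X]eq_fun do rewrite big_cons.
by apply: translation_continuousD => //; exact: measurable_sum.
Qed.

Lemma translation_continuous_approx f : measurable_fun setT f ->
  (forall e : R, 0 < e -> exists2 g, measurable_fun setT g /\
    translation_continuous g & (L1dist theta f g <= e%:E)%E) ->
  translation_continuous f.
Proof.
move=> mf fa e e0; have e3 : 0 < e / 3 by rewrite divr_gt0.
have [g [mg tg] fg] := fa _ e3.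
apply: filterS (tg _ e3) => v ge.
have -> : e = e / 3 + (e / 3 + e / 3).
  by field.
rewrite !EFinD.
apply: le_trans (@L1dist_triangle _ _ _ theta (translate v g) _ _ _ _ _) _ => //.
- exact: measurable_translate.
- exact: measurable_translate.
apply: leeD; first by rewrite L1dist_translate.
apply: le_trans (@L1dist_triangle _ _ _ theta g _ _ _ _ _) _ => //.
  exact: measurable_translate.
by apply: leeD => //; rewrite L1distC.
Qed.

End translation.

Section L1dist_iterated.
Context d (T : measurableType d) (R : realType) (mu : {measure set T -> \bar R}).
Hypothesis sf : sigma_finite setT mu.

Lemma integrable_slices (a : T * T -> R) :
  measurable_fun [set: T * T] a -> (forall p, 0 <= a p) ->
  (\int[mu]_x \int[mu]_y (a (x, y))%:E < +oo)%E ->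
  {ae mu, forall x, mu.-integrable setT (fun y => (a (x, y))%:E)}.
Proof.
move=> ma a0 aoo; have mEa : measurable_fun [set: T * T] (EFin \o a).
  exact/measurable_EFinP.
have a0' p : (0 <= (EFin \o a) p)%E by rewrite lee_fin.
have : mu.-integrable setT (fun x => \int[mu]_y (EFin \o a) (x, y))%E.
  apply/integrableP; split; first exact: measurable_integral2.
  rewrite (eq_integral (fun x => \int[mu]_y (EFin \o a) (x, y)))%E// => x _.
  by rewrite gee0_abs// integral_ge0.
move=> /(integrable_ae measurableT); apply: filterS => x /(_ I) xf.
apply/integrableP; split; first exact: (measurableT_comp mEa (measurable_pair1 x)).
under eq_integral do rewrite abse_EFin ger0_norm//.
by rewrite ltey; apply: contraTneq xf => ->.
Qed.

(** The common source of the convolution estimates below. The two finiteness conditions make almost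
    every slice integrable, so that the difference of the real integrals is the integral of the
    difference; Tonelli then exchanges the order. *)
Lemma L1dist_Rintegral_le (a b : T * T -> R) :
  measurable_fun [set: T * T] a -> (forall p, 0 <= a p) ->
  measurable_fun [set: T * T] b -> (forall p, 0 <= b p) ->
  (\int[mu]_x \int[mu]_y (a (x, y))%:E < +oo)%E ->
  (\int[mu]_x \int[mu]_y (b (x, y))%:E < +oo)%E ->
  (L1dist mu (fun x => \int[mu]_y a (x, y))%R (fun x => \int[mu]_y b (x, y))%R
   <= \int[mu]_y \int[mu]_x `|a (x, y) - b (x, y)|%:E)%E.
Proof.
move=> ma a0 mb b0 aoo boo.
have mab : measurable_fun [set: T * T] (fun p => `|a p - b p|%:E).
  by apply/measurable_EFinP/measurableT_comp => //; exact: measurable_funB.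
have mR (c : T * T -> R) : measurable_fun [set: T * T] c -> (forall p, 0 <= c p) ->
    measurable_fun setT (fun x => \int[mu]_y c (x, y))%R.
  move=> mc c0; apply: measurableT_comp; first exact: fine_measurable.
  apply: (@measurable_integral2 _ _ _ _ sf (EFin \o c)).
    exact/measurable_EFinP.
  by move=> p; rewrite lee_fin.
rewrite -(@tonelli _ _ _ _ sf (fun p => `|a p - b p|%:E))//.
apply: ae_ge0_le_integral => //.
- by apply: measurable_absB; exact: mR.
- by move=> x _; exact: integral_ge0.
- apply: (@measurable_integral2 _ _ _ _ sf (fun p => `|a p - b p|%:E)) => //.
apply: filterS2 (integrable_slices ma a0 aoo) (integrable_slices mb b0 boo).
move=> x ax bx _; rewrite -RintegralB//; apply: Rintegral_abs_le.
exact: (integrableB measurableT ax bx).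
Qed.

End L1dist_iterated.

Import HBSimple.

(** * L1 estimates for translations and convolutions *)

Section estimates.
Context (R : realType) (H : topologicalZmodType)
  (theta : {measure set (borel H) -> \bar R}).
Hypotheses (sc : @second_countable H) (sf : sigma_finite setT theta)
  (thH : is_haar theta) (hH : hausdorff_space H).
Implicit Types f g h : borel H -> R.

Lemma translation_continuous_sfun (g : {sfun borel H >-> R}) :
  theta.-integrable setT (EFin \o g) -> translation_continuous theta g.
Proof.
move=> Ig.
have mi (C : set (borel H)) : measurable C -> measurable_fun setT (\1_C : borel H -> R).
  by move=> mC; exact: measurable_indic.
have -> : (g : borel H -> R) = fun x =>
    \sum_(y <- finmap.enum_fset (fset_set (range g))) y * \1_(g @^-1` [set y]) x.
  by apply/funext => x; rewrite fimfunE fsbig_finite.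
apply: translation_continuous_sum => y.
  by apply: measurable_funM => //; exact: mi.
(* The level set of 0 may have infinite measure, but it contributes nothing; for any other value
   integrability bounds the measure of the level set. *)
have [->|y0] := eqVneq y 0.
  under [X in translation_continuous _ X]eq_fun do rewrite mul0r.
  exact: translation_continuous0.
apply: translation_continuousZ; first exact: mi.
apply: translation_continuous_indic => //.
have yp : 0 < `|y| by rewrite normr_gt0.
have /integrableP[_ /= goo] := Ig.
have : (`|y|%:E * theta (g @^-1` [set y]) < +oo)%E.
  apply: le_lt_trans goo.
  rewrite -[X in theta X]setIT -integral_indic// -ge0_integralZl//; last first.
    by apply/measurable_EFinP; exact: mi.
  apply: ge0_le_integral => //.
  - by apply: measurable_funeM; apply/measurable_EFinP; exact: mi.
  - by apply/measurable_EFinP/measurableT_comp.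
  - move=> x _; rewrite -EFinM lee_fin indicE.
    have [|_] := boolP (x \in _); last by rewrite mulr0.
    by rewrite inE /= => ->; rewrite mulr1.
by case: (theta _) => [r|/=|//]; rewrite ?ltry// gt0_muley// lte_fin.
Qed.

Lemma integrable_translation_continuous f :
  theta.-integrable setT (EFin \o f) -> translation_continuous theta f.
Proof.
move=> If; have mf : measurable_fun setT f.
  by apply/measurable_EFinP; exact: measurable_int If.
have [g [Ig _ fg]] := approximation_sfun_integrable measurableT If.
apply: translation_continuous_approx => // e e0.
have /fine_cvgP[gfin /cvgrPdist_le /(_ e e0) ge] := fg.
have [n [] fn en] : exists n, (\int[theta]_z `|(EFin \o f) z - (g n z)%:E|)%E \is a fin_num
   /\ `|0 - fine (\int[theta]_z `|(EFin \o f) z - (g n z)%:E|)%E| <= e.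
  by apply: (@filter_ex _ \oo); exact: filterI gfin ge.
exists (g n); first by split => //; exact: translation_continuous_sfun.
rewrite sub0r normrN ger0_norm in en; last by rewrite fine_ge0// integral_ge0.
by rewrite -lee_fin fineK// in en.
Qed.

Lemma density_translation_continuous f : density theta f ->
  translation_continuous theta f.
Proof. by move=> df; apply: integrable_translation_continuous; exact: density_integrable. Qed.

Lemma integral_convol_integrand f g : density theta f -> density theta g ->
  (\int[theta]_x \int[theta]_v (f (x - v : H) * g v)%:E = 1)%E.
Proof.
move=> [mf f0 f1] [mg g0 g1].
have := @integral_econvol _ _ theta sc sf thH (EFin \o f) (EFin \o g).
rewrite /= f1 g1 mul1e => <-//; first exact/measurable_EFinP.
exact/measurable_EFinP.
Qed.

Lemma integral_convol_integrand_lty f g : density theta f -> density theta g ->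
  (\int[theta]_x \int[theta]_v (f (x - v : H) * g v)%:E < +oo)%E.
Proof. by move=> df dg; rewrite integral_convol_integrand// ltry. Qed.

Lemma measurable_convol_integrand f g : measurable_fun setT f ->
  measurable_fun setT g ->
  measurable_fun [set: borel H * borel H] (fun p => f (p.1 - p.2 : H) * g p.2).
Proof.
move=> mf mg; apply: measurable_funM.
  exact: (measurableT_comp mf (measurable_sub2 sc)).
exact: (measurableT_comp mg measurable_snd).
Qed.

(** Translating a convolution amounts to translating its first factor; integrating out the second
    factor, of mass 1, leaves the displacement of [f]. *)
Lemma L1dist_translate_convol f g v : density theta f -> density theta g ->
  (L1dist theta (translate v (convol theta f g)) (convol theta f g) <=
   L1dist theta (translate v f) f)%E.
Proof.
move=> df dg; have [mf f0 f1] := df; have [mg g0 g1] := dg.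
have dvf : density theta (translate v f).
  split; [exact: measurable_translate | by move=> x; exact: f0|].
  rewrite (@ge0_integral_shift _ _ _ thH (EFin \o f))//; exact/measurable_EFinP.
have -> : translate v (convol theta f g) = convol theta (translate v f) g.
  apply/funext => x; apply: eq_Rintegral => y _.
  by rewrite /translate addrAC.
apply: le_trans (@L1dist_Rintegral_le _ _ _ theta sf
  (fun p => translate v f (p.1 - p.2 : H) * g p.2)
  (fun p => f (p.1 - p.2 : H) * g p.2) _ _ _ _ _ _) _.
- by apply: measurable_convol_integrand => //; case: dvf.
- by move=> p; rewrite mulr_ge0//; exact: f0.
- exact: measurable_convol_integrand.
- by move=> p; rewrite mulr_ge0.
- exact: (integral_convol_integrand_lty dvf dg).
- exact: (integral_convol_integrand_lty df dg).
have mab : measurable_fun setT (fun x => `|translate v f x - f x|%:E).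
  by apply: measurable_absB => //; exact: measurable_translate.
have -> : (\int[theta]_y \int[theta]_x `|translate v f ((x : H) - (y : H)) * g y -
     f ((x : H) - (y : H)) * g y|%:E =
   \int[theta]_y (L1dist theta (translate v f) f * (g y)%:E))%E.
  apply: eq_integral => y _.
  rewrite -[L1dist _ _ _](@ge0_integral_shift _ _ _ thH _ y mab)//.
  rewrite -ge0_integralZr//;
    [|exact: (measurableT_comp mab (measurable_shift y))|by rewrite lee_fin].
  by apply: eq_integral => x _; rewrite -mulrBl normrM (ger0_norm (g0 y)) EFinM.
rewrite ge0_integralZl//; last exact: L1dist_ge0.
  by rewrite g1 mule1.
- exact/measurable_EFinP.
- by move=> x _; rewrite lee_fin.
Qed.

Lemma measurable_L1dist_translate f : measurable_fun setT f ->
  measurable_fun setT (fun v : borel H => L1dist theta (translate v f) f).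
Proof.
move=> mf; apply: (@measurable_integral1 _ _ _ _ sf
  (fun p : borel H * borel H => `|f (p.1 - p.2 : H) - f p.1|%:E)).
  apply/measurable_EFinP/measurableT_comp => //; apply: measurable_funB.
    exact: (measurableT_comp mf (measurable_sub2 sc)).
  exact: (measurableT_comp mf measurable_fst).
by move=> p; rewrite lee_fin.
Qed.

Lemma L1dist_convol_id f phi : density theta f -> density theta phi ->
  (L1dist theta (convol theta f phi) f <=
   \int[theta]_v (L1dist theta (translate v f) f * (phi v)%:E))%E.
Proof.
move=> df dp; have [mf f0 f1] := df; have [mp p0 p1] := dp.
have mEp : measurable_fun setT (EFin \o phi) by exact/measurable_EFinP.
(* As [phi] has mass 1, [f] is itself an average over [phi], which makes it comparable with the
   convolution under a single integral. *)
have fx x : f x = (\int[theta]_v (f x * phi v))%R.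
  rewrite RintegralZl//; last exact: density_integrable.
  by rewrite /Rintegral p1 mulr1.
rewrite (_ : L1dist theta _ f = L1dist theta (convol theta f phi)
    (fun x => \int[theta]_v (f x * phi v))%R); last by congr L1dist; apply/funext.
apply: le_trans (@L1dist_Rintegral_le _ _ _ theta sf
  (fun p => f (p.1 - p.2 : H) * phi p.2) (fun p => f p.1 * phi p.2) _ _ _ _ _ _) _.
- exact: measurable_convol_integrand.
- by move=> p; rewrite mulr_ge0.
- by apply: measurable_funM;
    [exact: (measurableT_comp mf measurable_fst)|exact: (measurableT_comp mp measurable_snd)].
- by move=> p; rewrite mulr_ge0.
- exact: (integral_convol_integrand_lty df dp).
- rewrite (eq_integral (EFin \o f)); first by rewrite f1 ltry.
  move=> x _ /=; under eq_integral do rewrite EFinM.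
  by rewrite ge0_integralZl ?p1 ?mule1// => [y _|]; rewrite lee_fin.
rewrite le_eqVlt; apply/orP; left; apply/eqP.
apply: eq_integral => v _; rewrite -ge0_integralZr//; last 2 first.
- by apply: measurable_absB => //; exact: measurable_translate.
- by rewrite lee_fin.
by apply: eq_integral => x _; rewrite -mulrBl normrM (ger0_norm (p0 v)) EFinM.
Qed.

Lemma L1dist_convol f a b : density theta f -> density theta a -> density theta b ->
  (L1dist theta (convol theta f a) (convol theta f b) <= L1dist theta a b)%E.
Proof.
move=> df da db; have [mf f0 f1] := df; have [ma a0 a1] := da.
have [mb b0 b1] := db.
apply: le_trans (@L1dist_Rintegral_le _ _ _ theta sf
  (fun p => f (p.1 - p.2 : H) * a p.2) (fun p => f (p.1 - p.2 : H) * b p.2)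
  _ _ _ _ _ _) _.
- exact: measurable_convol_integrand.
- by move=> p; rewrite mulr_ge0.
- exact: measurable_convol_integrand.
- by move=> p; rewrite mulr_ge0.
- exact: (integral_convol_integrand_lty df da).
- exact: (integral_convol_integrand_lty df db).
have mEf : measurable_fun setT (EFin \o f) by exact/measurable_EFinP.
have Ef0 x : (0 <= (EFin \o f) x)%E by rewrite lee_fin.
rewrite le_eqVlt; apply/orP; left; apply/eqP.
apply: eq_integral => v _ /=.
rewrite -[RHS]mul1e -f1 -(ge0_integral_shift thH v mEf Ef0) -ge0_integralZr//.
- by apply: eq_integral => x _; rewrite -mulrBr normrM (ger0_norm (f0 _)) EFinM.
- exact: (measurableT_comp mEf (measurable_shift v)).
Qed.

End estimates.

(** * The iterated convolutions and their limit *)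

Section contraction.
Context (R : realType) (H : topologicalZmodType) (d : H -> H -> R)
  (A Ai : H -> H).
Hypotheses (dm : is_metric d) (dmz : metrizes d)
  (AA : topgroup_automorphism A Ai) (Ac : metric_contraction d A).

Lemma automorphism0 : A 0 = 0.
Proof. by case: AA => AD _ _ _ _; apply: (@addrI _ (A 0)); rewrite -AD !addr0. Qed.

Lemma iter_contraction : exists2 q : R, 0 <= q < 1 &
  forall n v, d 0 (iter n A v) <= q ^+ n * d 0 v.
Proof.
case: Ac => q q01 hq; exists q => // n v; elim: n => [|n ih].
  by rewrite expr0 mul1r.
have /andP[q0 _] := q01.
rewrite iterS exprS -mulrA -{1}automorphism0; apply: le_trans (hq _ _) _.
exact: ler_wpM2l.
Qed.

Lemma iter_automorphism_small (M : R) (U : set H) : nbhs 0 U ->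
  exists N, forall n v, (N <= n)%N -> d 0 v <= M -> U (iter n A v).
Proof.
move=> /dmz[r r0 rU]; have [q /andP[q0 q1] hq] := iter_contraction.
(* The denominator is positive and bounds [M] whatever the sign of [M]. *)
have rM : 0 < r / (`|M| + 1) by rewrite divr_gt0// ltr_pwDr.
have /cvgrPdist_lt/(_ _ rM)[N _ hN] : q ^+ n @[n --> \oo] --> (0 : R).
  by apply: cvg_expr; rewrite ger0_norm.
exists N => n v Nn vM; apply: rU => /=; apply: le_lt_trans (hq n v) _.
have := hN n Nn; rewrite /= sub0r normrN ger0_norm ?exprn_ge0// => qn.
apply: (@le_lt_trans _ _ (q ^+ n * (`|M| + 1))).
  rewrite ler_wpM2l ?exprn_ge0//; apply: le_trans vM _.
  by rewrite (le_trans (ler_norm M))// lerDl.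
by rewrite -ltr_pdivlMr// ltr_pwDr.
Qed.

Lemma automorphism_sigma_compact : locally_compact [set: H] ->
  exists K : nat -> set H, (forall n, compact (K n)) /\ \bigcup_n K n = setT.
Proof.
case: AA => AD AK AiK cA cAi lc; have [K nK [cK _]] := lc 0 I.
have {}nK : nbhs (0 : H) K.
  have : \forall x \near (0 : H), [set: H] x -> K x by exact: nK.
  by apply: filterS => x; exact.
exists (fun n => iter n Ai @` K); split.
  move=> n; apply: continuous_compact => //; apply: continuous_subspaceT.
  by elim: n => [|n ih] x; [exact: cvg_id | exact: (continuous_comp (ih x) (cAi _))].
apply/seteqP; split => // x _.
have [N hN] := iter_automorphism_small (d 0 x) nK.
exists N => //; exists (iter N A x); first exact: hN.
by elim: N {hN} => // n ih; rewrite iterSr /= AK.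
Qed.

Lemma group_second_countable : locally_compact [set: H] -> @second_countable H.
Proof.
by move=> /automorphism_sigma_compact[K [cK KT]]; exact: (sigma_compact_base dm dmz cK KT).
Qed.

Lemma haar_sigma_finite (theta : {measure set (borel H) -> \bar R}) :
  locally_compact [set: H] -> is_haar theta -> sigma_finite setT theta.
Proof.
move=> /automorphism_sigma_compact[K [cK KT]] thH; exists K => // n.
split; last exact: haar_compact thH _ (cK n).
by apply: closed_borel; exact: (metrizes_compact_closed dm dmz).
Qed.

End contraction.

(** * Algebra of the iterated convolutions *)

Section iterates.
Context (R : realType) (H : topologicalZmodType)
  (theta : {measure set (borel H) -> \bar R}) (A Ai : H -> H) (alpha : R)
  (h : borel H -> R).
Hypotheses (sc : @second_countable H) (sf : sigma_finite setT theta)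
  (thH : is_haar theta)
  (AA : topgroup_automorphism A Ai) (Aa : is_modulus theta A alpha)
  (dh : density theta h).

Local Notation T := (dilate Ai alpha).
Local Notation "f * g" := (convol theta f g).
Local Notation G := (convol_upto theta (fun l => iter l T h)).
Local Notation w := (fun v => L1dist theta (translate v h) h).

Lemma density_iter_dilate n f : density theta f -> density theta (iter n T f).
Proof. by move=> df; elim: n => // n ih; rewrite iterS; exact: (density_dilate AA Aa). Qed.

Lemma iter_convol_dilate n f g : density theta f -> density theta g ->
  iter n T f * iter n T g = iter n T (f * g).
Proof.
move=> df dg; elim: n => // n ih; rewrite !iterS -ih.
by apply: (convol_dilate AA Aa); exact: density_iter_dilate.
Qed.

Lemma density_upto n : density theta (G n).
Proof.
elim: n => // n ih /=; apply: density_convol => //.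
exact: (density_iter_dilate n.+1).
Qed.

Lemma convol_upto_split n k : G (n + k.+1)%N = G n * iter n.+1 T (G k).
Proof.
elim: k => [|k ih]; first by rewrite addn1.
have step m : G m.+1 = G m * iter m.+1 T h by [].
rewrite addnS step ih -addSn iterD.
rewrite convolA//; last 3 first.
- exact: density_upto.
- by apply: density_iter_dilate; exact: density_upto.
- by do 2!apply: density_iter_dilate.
by rewrite iter_convol_dilate//; [exact: density_upto | exact: density_iter_dilate].
Qed.

Lemma convol_upto_succ n : G n.+1 = h * T (G n).
Proof. by have := convol_upto_split 0 n. Qed.

Lemma L1dist_translate_upto n v :
  (L1dist theta (translate v (G n)) (G n) <= w v)%E.
Proof.
elim: n => [|n ih]; first exact: lexx.
apply: le_trans ih; apply: L1dist_translate_convol => //.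
  exact: density_upto.
exact: (density_iter_dilate n.+1).
Qed.

(** [iter n T f] is the density of the image under A^n of the measure with density [f]. This moves
    the contraction from the density into the argument of [F], where it brings points close to 0. *)
Lemma ge0_integral_iter_dilate n (F : borel H -> \bar R) f :
  measurable_fun setT F -> (forall x, 0 <= F x)%E -> density theta f ->
  (\int[theta]_v (F v * (iter n T f v)%:E) =
   \int[theta]_v (F (iter n A v) * (f v)%:E))%E.
Proof.
move=> mF F0 df; elim: n F mF F0 => // n ih F mF F0.
have [a0 _] := Aa; have [_ AK AiK _ _] := AA.
have [mf f0 _] := density_iter_dilate n df.
pose K (u : borel H) := (F (A u) * (iter n T f u)%:E)%E.
have mFA : measurable_fun setT (fun u : borel H => F (A u)).
  exact: (measurableT_comp mF (measurable_automorphism AA)).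
have mK : measurable_fun setT K.
  by apply: emeasurable_funM => //; exact/measurable_EFinP.
have K0 u : (0 <= K u)%E by rewrite mule_ge0// lee_fin.
have -> : (\int[theta]_v (F v * (iter n.+1 T f v)%:E) = \int[theta]_u K u)%E.
  rewrite -(ge0_integral_automorphism_inv AA Aa mK K0) -ge0_integralZl//.
  - by apply: eq_integral => v _; rewrite /K AiK iterS /dilate EFinM muleCA.
  - exact: (measurableT_comp mK (measurable_automorphism_inv AA)).
  - by rewrite lee_fin ltW.
rewrite (ih (fun u => F (A u)))//.
Qed.

Lemma L1dist_upto_convol n phi : density theta phi ->
  (L1dist theta (convol theta (G n) (iter n.+1 T phi)) (G n) <=
   \int[theta]_v (w (iter n.+1 A v) * (phi v)%:E))%E.
Proof.
move=> dp; have [mh _ _] := dh.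
have mw := measurable_L1dist_translate sc sf mh.
have dTp := density_iter_dilate n.+1 dp; have [mTp Tp0 _] := dTp.
have dG := density_upto n; have [mG _ _] := dG.
apply: le_trans (L1dist_convol_id sc sf thH dG dTp) _.
rewrite -(@ge0_integral_iter_dilate n.+1 w)//; last by move=> v; exact: L1dist_ge0.
apply: ge0_le_integral => //.
- by move=> v _; rewrite mule_ge0// ?lee_fin//; exact: L1dist_ge0.
- apply: emeasurable_funM; last exact/measurable_EFinP.
  exact: measurable_L1dist_translate.
- by apply: emeasurable_funM => //; exact/measurable_EFinP.
- move=> v _; apply: lee_wpmul2r; first by rewrite lee_fin.
  exact: L1dist_translate_upto.
Qed.

End iterates.

(** * Convergence of the iterated convolutions, and uniqueness of the fixed point *)

Section limit.
Context (R : realType) (H : topologicalZmodType) (d : H -> H -> R)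
  (theta : {measure set (borel H) -> \bar R}) (A Ai : H -> H) (alpha : R)
  (h : borel H -> R) (V W : set H).
Hypotheses (dm : is_metric d) (dmz : metrizes d)
  (dinv : translation_invariant_metric d) (Ac : metric_contraction d A)
  (sc : @second_countable H) (sf : sigma_finite setT theta)
  (thH : is_haar theta) (hH : hausdorff_space H)
  (AA : topgroup_automorphism A Ai) (Aa : is_modulus theta A alpha)
  (dh : density theta h) (hV : forall x, h x != 0 -> V x)
  (W0 : W !=set0) (cW : compact W)
  (WV : forall x v, W x -> V v -> W (A x + v)).

Local Notation T := (dilate Ai alpha).
Local Notation "f * g" := (convol theta f g).
Local Notation G := (convol_upto theta (fun l => iter l T h)).
Local Notation w := (fun v => L1dist theta (translate v h) h).

Lemma convol_neq0 (f g : borel H -> R) x : (f * g) x != 0 ->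
  exists v : H, f (x - v) != 0 /\ g v != 0.
Proof.
apply: contra_neqP => /forallNP fg.
transitivity (\int[theta]_v (cst 0 v))%R; last by rewrite /Rintegral integral0.
apply: eq_Rintegral => v _ /=; have := fg v.
have [->|fv] := eqVneq (f (x - v : H)) 0; first by rewrite mul0r.
by have [->|gv /not_andP[]] := eqVneq (g v) 0; first by rewrite mulr0.
Qed.

(* The partial sums [v_0 + A v_1 + ... + A^n v_n] of points of [V] are mapped
   into [W] by adding [A^(n+1) y], for [y] in [W]. *)
Lemma upto_support n x y : W y -> G n x != 0 -> W (x + iter n.+1 A y).
Proof.
move=> Wy; elim: n x => [|n ih] x.
  by move=> /hV Vx; rewrite addrC; exact: WV.
rewrite (convol_upto_succ sc sf thH AA Aa dh) convolC//; first last.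
- exact: (density_iter_dilate AA Aa 1 (density_upto sc sf thH AA Aa dh n)).
move=> /convol_neq0[v [Tx /hV Vv]].
have /ih Wn : G n (Ai (x - v)) != 0.
  by apply: contraNneq Tx => Gx; rewrite /dilate Gx mulr0.
have [AD _ AiK _ _] := AA.
have := WV Wn Vv; rewrite AD AiK -iterS; congr W.
by rewrite addrAC subrK.
Qed.

(** [upto_support] puts x + A^(n+1) y in the bounded set [W] for one fixed [y], and A^(n+1) y is
    never farther from 0 than [y]; neither bound depends on [n]. *)
Lemma upto_bounded : exists M, forall n x, G n x != 0 -> d 0 x <= M.
Proof.
have [M hM] := compact_dbounded dm dmz cW; have [y Wy] := W0.
have [d0 _ ds dt] := dm.
have [q /andP[q0 q1] hq] := iter_contraction AA Ac.
exists (M + d 0 y) => n x /(upto_support Wy) /hM Mx.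
set u := iter n.+1 A y in Mx.
apply: le_trans (dt _ (x + u) _) _; apply: lerD => //.
rewrite (dist_subr dinv) opprD addrA subrr sub0r.
rewrite -(dinv _ _ u) add0r addNr ds; apply: le_trans (hq _ _) _.
by rewrite ler_piMl// exprn_ile1// ltW.
Qed.

Lemma modulus_iter_small (M e : R) : 0 < e ->
  exists N, forall n v, (N <= n)%N -> d 0 v <= M -> (w (iter n A v) <= e%:E)%E.
Proof.
move=> e0; have tc := density_translation_continuous thH hH dh.
by have := iter_automorphism_small dmz AA Ac M (tc e e0).
Qed.

Lemma upto_cauchy (e : R) : 0 < e -> exists N, forall m n, (N <= m)%N ->
  (N <= n)%N -> (L1dist theta (G m) (G n) <= e%:E)%E.
Proof.
move=> e0; have [M hM] := upto_bounded.
have [N hN] := modulus_iter_small M e0.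
suff le_mn m n : (N <= n)%N -> (n <= m)%N -> (L1dist theta (G m) (G n) <= e%:E)%E.
  exists N => m n Nm Nn; have [nm|/ltnW mn] := leqP n m; first exact: le_mn.
  by rewrite L1distC; exact: le_mn.
move=> Nn; rewrite leq_eqVlt => /predU1P[<-|nm].
  rewrite /L1dist; under eq_integral do rewrite subrr normr0.
  by rewrite integral0 lee_fin ltW.
(* With k = m - (n+1), [G m] is the convolution of [G n] with T^(n+1) ([G k]), which is what
   [L1dist_upto_convol] compares with [G n]. *)
rewrite -(subnKC nm) addSnnS (convol_upto_split sc sf thH AA Aa dh).
have dG := density_upto sc sf thH AA Aa dh (m - n.+1); have [mG G0 G1] := dG.
apply: le_trans (L1dist_upto_convol sc sf thH AA Aa dh n dG) _.
have mEG : measurable_fun setT (EFin \o G (m - n.+1)%N) by exact/measurable_EFinP.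
have EG0 x : (0 <= (EFin \o G (m - n.+1)) x)%E by rewrite lee_fin.
have -> : (e%:E = \int[theta]_v (e%:E * (EFin \o G (m - n.+1)) v))%E.
  by rewrite ge0_integralZl// ?lee_fin ?ltW// G1 mule1.
apply: ge0_le_integral => //.
- by move=> v _; apply: mule_ge0; [exact: L1dist_ge0 | exact: EG0].
- apply: emeasurable_funM => //.
  have mw : measurable_fun setT (w : borel H -> \bar R).
    by apply: (measurable_L1dist_translate sc sf); case: dh.
  have mA : measurable_fun setT (iter n.+1 A : borel H -> borel H).
    elim: n.+1 => [|k ih]; first exact: measurable_id.
    exact: (measurableT_comp (measurable_automorphism AA) ih).
  exact: (measurableT_comp mw mA).
- exact: measurable_funeM.
(* The bound on [w] is only known on the support of [G] at index m - (n+1); elsewhere both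
   integrands vanish. *)
- move=> v _; have [Gv|Gv] := eqVneq (G (m - n.+1)%N v) 0.
    have GEv : (EFin \o G (m - n.+1)%N) v = 0%E by congr EFin.
    by rewrite [X in (_ * X <= _)%E]GEv [X in (_ <= _ * X)%E]GEv !mule0.
  apply: lee_wpmul2r; first exact: EG0.
  exact: (hN n.+1 v (leqW Nn) (hM _ _ Gv)).
Qed.

Lemma measurable_upto n : measurable_fun setT (G n).
Proof. by case: (density_upto sc sf thH AA Aa dh n). Qed.

Lemma upto_limit : exists g, [/\ density theta g, forall x, g x != 0 -> W x &
  L1dist theta (G n) g @[n --> \oo] --> 0%E].
Proof.
have [g [phi [mg gphi Gg cg]]] := L1_complete measurable_upto upto_cauchy.
have clW : closed W by exact: (metrizes_compact_closed dm dmz).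
have mW : measurable (W : set (borel H)) by exact: closed_borel.
have [y Wy] := W0.
have gW : {ae theta, forall x, 0 <= g x /\ (~ W x -> g x = 0)}.
  apply: filterS Gg => x xg; split.
    apply: (cvgr_to_ge xg); apply: nearW => n.
    by case: (density_upto sc sf thH AA Aa dh (phi n)).
  move=> nWx; apply: (cvg_unique (@norm_hausdorff _ R^o) xg).
  (* For [x] outside the closed set [W], x + A^(n+1) y is eventually outside [W] too, since A^(n+1)
     y tends to 0. By [upto_support] the sequence is then eventually 0 at [x], and so is the
     subsequence. *)
  have : nbhs (0 : H) (fun u => (~` W) (x + u)).
    apply: (@cvg_comp _ _ _ (fun u => (x, u)) (fun p : H * H => p.1 + p.2) _ (nbhs (x, 0))).
    - by apply: cvg_pair; [exact: cvg_cst|exact: cvg_id].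
    - exact: add_continuous.
    - rewrite /= addr0; apply: open_nbhs_nbhs; split => //; exact: closed_openC.
  move=> /(iter_automorphism_small dmz AA Ac (d 0 y))[N hN].
  apply: cvg_near_cst; exists N => // n /= Nn.
  apply/eqP/negPn/negP => /(upto_support Wy).
  by apply: hN => //; apply: leqW; apply: leq_trans Nn _.
(* A representative of the limit with the sign and the support condition at every point. *)
pose g1 (x : borel H) := (\1_W x * g^\+ x)%R.
have gg1 : {ae theta, forall x, g x = g1 x}.
  apply: filterS gW => x [g0 gx]; rewrite /g1 indicE.
  have [xW|/negP xW] := boolP (x \in W); first by rewrite mul1r /funrpos max_l.
  by rewrite mul0r gx// => Wx; apply: xW; rewrite inE.
have mg1 : measurable_fun setT g1.
  by apply: measurable_funM; [exact: measurable_indic | exact: measurable_funrpos].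
have cg1 : L1dist theta (G n) g1 @[n --> \oo] --> 0%E.
  apply: cvg_trans cg; apply: near_eq_cvg; apply: nearW => n.
  apply: ae_eq_L1dist => //; try exact: measurable_upto.
  exact: aeW.
have g10 x : 0 <= g1 x by rewrite mulr_ge0// /funrpos le_max lexx orbT.
exists g1; split => //.
- split => //; have G1 n : (\int[theta]_x (G n x)%:E = 1)%E.
    by case: (density_upto sc sf thH AA Aa dh n).
  have G0 n x : 0 <= G n x by case: (density_upto sc sf thH AA Aa dh n).
  have mEg1 : measurable_fun setT (EFin \o g1) by exact/measurable_EFinP.
  have D0 n x : (0 <= `|G n x - g1 x|%:E)%E by rewrite lee_fin.
  have mD n : measurable_fun setT (fun x => `|G n x - g1 x|%:E).
    by apply: measurable_absB => //; exact: measurable_upto.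
  (* The masses of [G N] and [g1] differ by at most their L1 distance, in either direction. *)
  apply/eqP; rewrite eq_le; apply/andP; split; apply/lee_addgt0Pr => e e0;
    have [N /(_ N (leqnn N)) hN] := cvge0_near cg1 e0.
  - apply: le_trans (leeD2l _ hN); rewrite -{1}(G1 N) -ge0_integralD//;
      [|by move=> x _; rewrite lee_fin|by apply/measurable_EFinP; exact: measurable_upto].
    apply: ge0_le_integral => //.
    + by move=> x _; rewrite lee_fin.
    + by apply: emeasurable_funD => //; apply/measurable_EFinP; exact: measurable_upto.
    + move=> x _; rewrite -EFinD lee_fin -lerBlDl distrC; exact: ler_norm.
  - apply: le_trans (leeD2l _ hN); rewrite -{1}(G1 N) -ge0_integralD//;
      [|by move=> x _; rewrite lee_fin].
    apply: ge0_le_integral => //.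
    + by move=> x _; rewrite lee_fin.
    + by apply/measurable_EFinP; exact: measurable_upto.
    + exact: emeasurable_funD.
    + move=> x _; rewrite -EFinD lee_fin -lerBlDl; exact: ler_norm.
- move=> x; rewrite /g1 indicE; have [|_] := boolP (x \in W); first by rewrite inE.
  by rewrite mul0r eqxx.
Qed.

Lemma L1dist_dilate f g : measurable_fun setT f -> measurable_fun setT g ->
  L1dist theta (T f) (T g) = L1dist theta f g.
Proof.
move=> mf mg; have [a0 _] := Aa.
have mD : measurable_fun setT (fun x => `|f x - g x|%:E) by exact: measurable_absB.
have D0 x : (0 <= `|f x - g x|%:E)%E by rewrite lee_fin.
rewrite /L1dist -(ge0_integral_automorphism_inv AA Aa mD D0) -ge0_integralZl//.
- apply: eq_integral => x _.
  by rewrite /dilate -mulrBr normrM (gtr0_norm a0) EFinM.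
- exact: (measurableT_comp mD (measurable_automorphism_inv AA)).
- by rewrite lee_fin ltW.
Qed.

(** The map f |-> h * T f does not increase the L1 distance and sends [G N] to [G N.+1], so [g] and
    h * T g are limits of the same sequence. *)
Lemma limit_fixed g : density theta g ->
  L1dist theta (G n) g @[n --> \oo] --> 0%E ->
  {ae theta, forall x, g x = (h * T g) x}.
Proof.
move=> dg cg; have [mg _ _] := dg.
have dTg := density_dilate AA Aa dg.
have dhTg := density_convol sc sf thH dh dTg; have [mhTg _ _] := dhTg.
apply: (@L1dist_eq0 _ _ _ theta) => //.
apply/eqP; rewrite eq_le L1dist_ge0 andbT; apply/lee_addgt0Pr => e e0.
have e2 : 0 < e / 2 by rewrite divr_gt0.
rewrite add0e; have [N hN] := cvge0_near cg e2.
apply: le_trans (@L1dist_triangle _ _ _ theta (G N.+1) _ _ mg (measurable_upto _) mhTg) _.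
rewrite (splitr e) EFinD; apply: leeD; first by rewrite L1distC; exact: hN.
rewrite (convol_upto_succ sc sf thH AA Aa dh).
have dG := density_upto sc sf thH AA Aa dh N.
apply: le_trans (L1dist_convol sc sf thH dh (density_dilate AA Aa dG) dTg) _.
by rewrite L1dist_dilate//; [exact: hN | exact: measurable_upto].
Qed.

Lemma ae_iter_dilate n f g : {ae theta, forall x, f x = g x} ->
  {ae theta, forall x, iter n T f x = iter n T g x}.
Proof.
move=> fg; elim: n => // n ih.
by apply: filterS (ae_automorphism_inv AA Aa ih) => x; rewrite /= /dilate => ->.
Qed.

(** Inserting the fixed-point equation into the last factor T^(n+1) g splits it as T^(n+1) h
    convolved with T^(n+2) g, and the first of these is absorbed by [G n]. *)
Lemma fixed_iter g n : density theta g ->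
  {ae theta, forall x, g x = (h * T g) x} ->
  {ae theta, forall x, g x = (G n * iter n.+1 T g) x}.
Proof.
move=> dg gE; elim: n => // n ih; apply: filterS ih => x ->.
have dI m f : density theta f -> density theta (iter m T f).
  exact: (density_iter_dilate AA Aa).
have dTg := density_dilate AA Aa dg.
have dhTg := density_convol sc sf thH dh dTg; have [mhTg _ _] := dhTg.
have dG := density_upto sc sf thH AA Aa dh n.
have -> : G n.+1 = G n * iter n.+1 T h by [].
rewrite (iterSr n.+1 T g) convolA//; [|exact: (dI n.+1)|exact: (dI n.+1)].
rewrite (iter_convol_dilate AA Aa n.+1 dh dTg).
congr (_ x); apply: convol_ae => //; last exact: ae_iter_dilate.
- by case: dG.
- by case: dG.
- by case: (dI n.+1 _ dg).
- by case: (dI n.+1 _ dhTg).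
- exact: aeW.
Qed.

Lemma translate_modulus_le2 v : (w v <= 2%:E)%E.
Proof.
have [mh h0 h1] := dh.
have mEh : measurable_fun setT (EFin \o h) by exact/measurable_EFinP.
have Eh0 x : (0 <= (EFin \o h) x)%E by rewrite lee_fin.
have mtEh : measurable_fun setT (fun x : borel H => (h ((x : H) - v))%:E).
  exact: (measurableT_comp mEh (measurable_shift v)).
have -> : (2%:E = \int[theta]_x ((h ((x : H) - v))%:E + (h x)%:E) :> \bar R)%E.
  rewrite ge0_integralD//; try by move=> x _; rewrite lee_fin.
  by rewrite (ge0_integral_shift thH v mEh Eh0) h1 -EFinD.
apply: ge0_le_integral => //.
- by apply: measurable_absB => //; exact: measurable_translate.
- exact: emeasurable_funD.
- move=> x _; rewrite -EFinD lee_fin /translate.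
  by rewrite (le_trans (ler_normB _ _))// !ger0_norm.
Qed.

Lemma fixed_L1dist g : density theta g ->
  {ae theta, forall x, g x = (h * T g) x} ->
  L1dist theta (G n) g @[n --> \oo] --> 0%E.
Proof.
move=> dg gE; have [mg g0 g1] := dg; have [mh h0 h1] := dh.
have mEg : measurable_fun setT (EFin \o g) by exact/measurable_EFinP.
have mw : measurable_fun setT (w : borel H -> \bar R).
  exact: (measurable_L1dist_translate sc sf).
have mA n : measurable_fun setT (iter n A : borel H -> borel H).
  elim: n => [|n ih]; first exact: measurable_id.
  exact: (measurableT_comp (measurable_automorphism AA) ih).
pose F n (v : borel H) := (w (iter n.+1 A v) * (g v)%:E)%E.
have mF n : measurable_fun setT (F n).
  by apply: emeasurable_funM => //; exact: (measurableT_comp mw (mA n.+1)).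
have F0 n v : (0 <= F n v)%E.
  by rewrite mule_ge0 ?lee_fin//; exact: L1dist_ge0.
have cF : (\int[theta]_v F n v)%E @[n --> \oo] --> 0%E.
  rewrite -(integral0 theta setT).
  (* The dominating function is 2 g, since [w] never exceeds the total mass 2 of [h] and its
     translate. *)
  have := @dominated_convergence _ _ _ theta setT measurableT F (cst 0%E)
    (fun v => 2%:E * (g v)%:E)%E mF (measurable_cst _).
  case=> //.
  - apply: aeW => v _; apply: cvge0_le => // e e0.
    (* Chosen so that the product with [g v] stays below [e], also when [g v] is 0. *)
    have e1 : 0 < e / (g v + 1) by rewrite divr_gt0// ltr_wpDl.
    have [N hN] := modulus_iter_small (d 0 v) e1.
    exists N => n Nn; apply: (@le_trans _ _ ((e / (g v + 1))%:E * (g v)%:E)%E).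
      by apply: lee_wpmul2r; [rewrite lee_fin | apply: hN => //; exact: leqW].
    rewrite -EFinM lee_fin mulrAC ler_pdivrMr ?ltr_wpDl//.
    by apply: ler_wpM2l; [exact: ltW | rewrite lerDl].
  - apply: integrableZl => //; exact: density_integrable.
  - apply: aeW => v n _; rewrite gee0_abs//; apply: lee_wpmul2r.
      by rewrite lee_fin.
    exact: translate_modulus_le2.
apply: cvge0_le => [n|e /(cvge0_near cF)[N hN]]; first exact: L1dist_ge0.
exists N => n /hN; apply: le_trans.
have dI : density theta (iter n.+1 T g) by exact: (density_iter_dilate AA Aa).
have dG := density_upto sc sf thH AA Aa dh n.
have [mGI _ _] := density_convol sc sf thH dG dI.
rewrite L1distC (@ae_eq_L1dist _ _ _ theta g (G n * iter n.+1 T g) (G n) (G n))//.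
- exact: L1dist_upto_convol.
- by case: dG.
- by case: dG.
- exact: fixed_iter.
- exact: aeW.
Qed.

Lemma fixed_unique g g' : density theta g -> density theta g' ->
  {ae theta, forall x, g x = (h * T g) x} ->
  {ae theta, forall x, g' x = (h * T g') x} ->
  {ae theta, forall x, g' x = g x}.
Proof.
move=> dg dg' /(fixed_L1dist dg) cg /(fixed_L1dist dg') cg'.
have [[mg _ _] [mg' _ _]] := (dg, dg').
apply: (@L1dist_eq0 _ _ _ theta) => //.
apply/eqP; rewrite eq_le L1dist_ge0 andbT; apply/lee_addgt0Pr => e e0.
have e2 : 0 < e / 2 by rewrite divr_gt0.
have [N hN] := cvge0_near cg e2; have [N' hN'] := cvge0_near cg' e2.
rewrite add0e (splitr e) EFinD.
apply: le_trans (@L1dist_triangle _ _ _ theta (G (maxn N N')) _ _ mg'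
  (measurable_upto _) mg) _.
by apply: leeD; [rewrite L1distC; apply: hN'; exact: leq_maxr
                |apply: hN; exact: leq_maxl].
Qed.

End limit.

(** * Fourier transforms *)

Section bounded_weight.
Context (R : realType) (H : topologicalZmodType)
  (theta : {measure set (borel H) -> \bar R}).
Hypotheses (sc : @second_countable H) (sf : sigma_finite setT theta)
  (thH : is_haar theta).
Implicit Types (f g phi psi : borel H -> R).

Local Notation J phi f := (\int[theta]_x (phi x * f x)).

(** The real and imaginary parts of a character are such weights; the Fourier transform is handled
    as a pair of real weighted integrals. *)
Definition unit_bounded phi := measurable_fun setT phi /\ forall x, `|phi x| <= 1.

Lemma unit_bounded_integrable phi f : unit_bounded phi ->
  theta.-integrable setT (EFin \o f) ->
  theta.-integrable setT (fun x => (phi x * f x)%:E).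
Proof.
move=> [mp p1] If; have mf : measurable_fun setT f.
  by apply/measurable_EFinP; exact: measurable_int If.
apply: le_integrable If => //; first exact/measurable_EFinP/measurable_funM.
by move=> x _; rewrite /= lee_fin normrM ler_piMl.
Qed.

Lemma unit_bounded_ge0 phi x : unit_bounded phi -> 0 <= phi x + 1.
Proof. by case=> _ /(_ x); rewrite ler_norml => /andP[+ _]; rewrite -subr_ge0 opprK. Qed.

(* Adding 1 to the weight makes the integrand nonnegative, which reduces the
   integrals below to Tonelli's theorem. *)
Lemma weighted_integralD1 phi f : unit_bounded phi -> density theta f ->
  ((J phi f + 1)%:E = \int[theta]_x ((phi x + 1)%:E * (f x)%:E))%E.
Proof.
move=> bp df; have If := density_integrable df; have [mf f0 f1] := df.
have Ipf := unit_bounded_integrable bp If.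
have E1 : 1 = \int[theta]_x f x by rewrite /Rintegral f1.
rewrite [in LHS]E1 -RintegralD// /Rintegral fineK; last first.
  apply: integrable_fin_num => //; exact: (integrableD measurableT Ipf If).
by apply: eq_integral => x _; rewrite -EFinM mulrDl mul1r.
Qed.

Lemma weighted_integral_le1 phi f : unit_bounded phi -> density theta f ->
  `|J phi f| <= 1.
Proof.
move=> bp df; have If := density_integrable df; have [mf f0 f1] := df.
have Ipf := unit_bounded_integrable bp If; have [mp p1] := bp.
rewrite -lee_fin; apply: le_trans (Rintegral_abs_le Ipf) _.
rewrite -f1; apply: ge0_le_integral => //.
- by apply/measurable_EFinP/measurableT_comp => //; exact: measurable_funM.
- exact/measurable_EFinP.
- by move=> x _; rewrite lee_fin normrM (ger0_norm (f0 x)) ler_piMl.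
Qed.

Lemma unit_bounded_shift phi v : unit_bounded phi ->
  unit_bounded (fun x : borel H => phi ((x : H) + v)).
Proof.
case=> mp p1; split; first exact: (measurableT_comp mp (measurable_shiftD v)).
by move=> x; exact: p1.
Qed.

(** Makes the inner integral of [weighted_integral_convol] an admissible weight in its turn. *)
Lemma unit_bounded_weighted phi f : unit_bounded phi -> density theta f ->
  unit_bounded (fun v => J (fun x : borel H => phi ((x : H) + (v : H))) f).
Proof.
move=> bp df; have [mf f0 f1] := df; split; last first.
  by move=> v; apply: weighted_integral_le1 => //; exact: unit_bounded_shift.
have [mp _] := bp.
pose K (p : borel H * borel H) := ((phi (p.1 + p.2 : H) + 1)%:E * (f p.1)%:E)%E.
have mK : measurable_fun [set: borel H * borel H] K.
  apply: emeasurable_funM; apply/measurable_EFinP; last first.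
    exact: (measurableT_comp mf measurable_fst).
  apply: measurable_funD => //; exact: (measurableT_comp mp (measurable_add2 sc)).
have K0 p : (0 <= K p)%E.
  by rewrite mule_ge0// lee_fin//; exact: unit_bounded_ge0.
have mJ := measurable_integral1 sf mK K0.
rewrite (_ : (fun v => _) = fun v : borel H => fine (\int[theta]_x K (x, v))%E - 1).
  by apply: measurable_funB => //; apply: measurableT_comp => //; exact: fine_measurable.
apply/funext => v.
by rewrite -(weighted_integralD1 (unit_bounded_shift v bp) df)/= addrK.
Qed.

Lemma weighted_integral_convol phi f g : unit_bounded phi ->
  density theta f -> density theta g ->
  J phi (convol theta f g) =
  J (fun v : borel H => J (fun x : borel H => phi ((x : H) + (v : H))) f) g.
Proof.
move=> bp df dg; apply: (addIr 1); apply: EFin_inj.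
have dc := density_convol sc sf thH df dg.
rewrite (weighted_integralD1 bp dc).
rewrite (weighted_integralD1 (unit_bounded_weighted bp df) dg).
have [mp _] := bp; have [mf f0 _] := df; have [mg g0 _] := dg.
have mEp : measurable_fun setT (fun x => (phi x + 1)%:E).
  by apply/measurable_EFinP; exact: measurable_funD.
have p0 x : (0 <= (phi x + 1)%:E)%E by rewrite lee_fin; exact: unit_bounded_ge0.
have mEf : measurable_fun setT (EFin \o f) by exact/measurable_EFinP.
have mEg : measurable_fun setT (EFin \o g) by exact/measurable_EFinP.
have Ef0 x : (0 <= (EFin \o f) x)%E by rewrite lee_fin.
have Eg0 x : (0 <= (EFin \o g) x)%E by rewrite lee_fin.
have mec := measurable_econvol sc sf mEf mEg Ef0 Eg0.
transitivity (\int[theta]_x ((phi x + 1)%:E * econvol theta (EFin \o f) (EFin \o g) x))%E.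
  apply: ae_eq_integral => //.
  - by apply: emeasurable_funM => //; apply/measurable_EFinP; case: dc.
  - exact: emeasurable_funM.
  - by apply: filterS (ae_convolE sc sf thH df dg) => x -> _.
transitivity (\int[theta]_x \int[theta]_v ((phi x + 1)%:E *
    ((f (x - v : H))%:E * (g v)%:E)))%E.
  apply: eq_integral => x _; rewrite -ge0_integralZl//.
  - exact: (measurable_econvol_integrandl mEf mEg).
  - by move=> v _; rewrite mule_ge0// lee_fin.
rewrite (@tonelli _ _ _ _ sf (fun p : borel H * borel H => (phi p.1 + 1)%:E *
    ((f (p.1 - p.2 : H))%:E * (g p.2)%:E)))%E; last 2 first.
- apply: emeasurable_funM; first exact: (measurableT_comp mEp measurable_fst).
  exact: (measurable_econvol_integrand sc mEf mEg).
- by move=> p; rewrite !mule_ge0// lee_fin.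
apply: eq_integral => v _ /=.
rewrite (weighted_integralD1 (unit_bounded_shift v bp) df).
have mK : measurable_fun setT
    (fun x : borel H => (phi ((x : H) + (v : H)) + 1)%:E * (f x)%:E)%E.
  by apply: emeasurable_funM => //; exact: (measurableT_comp mEp (measurable_shiftD v)).
have K0 (x : borel H) : (0 <= (phi ((x : H) + (v : H)) + 1)%:E * (f x)%:E)%E.
  by rewrite mule_ge0// lee_fin.
rewrite -(ge0_integral_shift thH v mK K0) -ge0_integralZr//.
- by apply: eq_integral => x _; rewrite subrK muleA.
- exact: (measurableT_comp mK (measurable_shift v)).
- by rewrite lee_fin.
Qed.

Lemma weighted_integral_iter_dilate (A Ai : H -> H) (alpha : R) n phi f :
  topgroup_automorphism A Ai -> is_modulus theta A alpha ->
  unit_bounded phi -> density theta f ->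
  J phi (iter n (dilate Ai alpha) f) = J (fun x : borel H => phi (iter n A x)) f.
Proof.
move=> AA Aa bp df; apply: (addIr 1); apply: EFin_inj; have [mp p1] := bp.
have mA : measurable_fun setT (iter n A : borel H -> borel H).
  elim: n => [|n ih]; first exact: measurable_id.
  exact: (measurableT_comp (measurable_automorphism AA) ih).
rewrite (weighted_integralD1 bp); last exact: (density_iter_dilate AA Aa).
rewrite weighted_integralD1//; last first.
  by split; [exact: (measurableT_comp mp mA) | move=> x; exact: p1].
apply: (@ge0_integral_iter_dilate _ _ _ _ _ _ AA Aa n (fun x => (phi x + 1)%:E)) => //.
- by apply/measurable_EFinP; exact: measurable_funD.
- by move=> x; rewrite lee_fin; exact: unit_bounded_ge0.
Qed.

Lemma weighted_integral_dist phi f g : unit_bounded phi ->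
  theta.-integrable setT (EFin \o f) -> theta.-integrable setT (EFin \o g) ->
  (`|J phi f - J phi g|%:E <= L1dist theta f g)%E.
Proof.
move=> bp If Ig; have [mp p1] := bp.
have mf : measurable_fun setT f.
  by apply/measurable_EFinP; exact: measurable_int If.
have mg : measurable_fun setT g.
  by apply/measurable_EFinP; exact: measurable_int Ig.
have Ipf := unit_bounded_integrable bp If; have Ipg := unit_bounded_integrable bp Ig.
rewrite -RintegralB//; apply: le_trans (Rintegral_abs_le _) _.
  exact: (integrableB measurableT Ipf Ipg).
apply: ge0_le_integral => //.
- by apply: measurable_absB; exact: measurable_funM.
- exact: measurable_absB.
- by move=> x _; rewrite lee_fin -mulrBr normrM ler_piMl.
Qed.

Lemma weighted_integral_support phi psi f (W : set H) (e : R) :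
  unit_bounded phi -> unit_bounded psi -> density theta f ->
  (forall x, f x != 0 -> W x) -> (forall x, W x -> `|phi x - psi x| <= e) ->
  `|J phi f - J psi f| <= e.
Proof.
move=> bp bq df fW We; have If := density_integrable df; have [mf f0 f1] := df.
have [[mp _] [mq _]] := (bp, bq).
have Ipf := unit_bounded_integrable bp If; have Iqf := unit_bounded_integrable bq If.
have mEf : measurable_fun setT (EFin \o f) by exact/measurable_EFinP.
(* A negative [e] would make [f] vanish everywhere, against its mass 1. *)
have e0 : 0 <= e.
  have [e0|e0] := leP 0 e; first by [].
  have f00 x : f x = 0.
    apply/eqP/negPn/negP => /fW/We; rewrite leNgt (lt_le_trans e0)//.
  by move: f1; under eq_integral do rewrite f00; rewrite integral0 => /eqP; rewrite eqe eq_sym oner_eq0.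
rewrite -lee_fin -RintegralB//; apply: le_trans (Rintegral_abs_le _) _.
  exact: (integrableB measurableT Ipf Iqf).
have -> : (e%:E = \int[theta]_x (e%:E * (EFin \o f) x))%E.
  by rewrite ge0_integralZl// ?f1 ?mule1// => x _; rewrite lee_fin.
apply: ge0_le_integral => //.
- by apply: measurable_absB; exact: measurable_funM.
- exact: measurable_funeM.
- move=> x _; rewrite -EFinM lee_fin -mulrBl normrM (ger0_norm (f0 x)).
  have [->|/fW/We] := eqVneq (f x) 0; first by rewrite !mulr0.
  exact: ler_wpM2r.
Qed.

End bounded_weight.

Section complex_facts.
Context (R : realType).

Lemma norm_complex_le (z : R[i]) (a b : R) :
  `|complex.Re z| <= a -> `|complex.Im z| <= b -> `|z| <= (a + b)%:C%C.
Proof.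
move=> xa yb; have a0 := le_trans (normr_ge0 _) xa.
have b0 := le_trans (normr_ge0 _) yb.
rewrite normc_def lecR -[leRHS]ger0_norm ?addr_ge0// -sqrtr_sqr ler_wsqrtr//.
move: xa yb; rewrite !ler_norml => /andP[xa xa'] /andP[yb yb']; nra.
Qed.

Lemma Re_le_norm (z : R[i]) (a : R) : `|z| <= a%:C%C -> `|complex.Re z| <= a.
Proof. by move=> za; rewrite -lecR; exact: le_trans (normc_ge_Re z) za. Qed.

Lemma Im_le_norm (z : R[i]) (a : R) : `|z| <= a%:C%C -> `|complex.Im z| <= a.
Proof.
rewrite normc_def lecR; apply: le_trans.
by rewrite -sqrtr_sqr ler_wsqrtr// lerDr sqr_ge0.
Qed.

(** Positive elements of [R[i]] are real, so every epsilon of its topology may be taken in [R]. *)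
Lemma complex_gt0P (e : R[i]) : 0 < e -> exists2 r : R, 0 < r & e = r%:C%C.
Proof.
by case: e => a b; rewrite ltcE /= => /andP[/eqP -> a0]; exists a.
Qed.

Lemma Re_continuous : continuous (@complex.Re R : R[i]^o -> R).
Proof.
move=> z; have FF : Filter (nbhs (z : R[i]^o)) by exact: nbhs_filter.
apply/cvgrPdist_le => e e0.
have e0' : 0 < e%:C%C by rewrite ltcR.
have /cvgrPdist_le/(_ _ e0') : (y : R[i]^o) @[y --> z] --> z by exact: cvg_id.
by apply: filterS => y zy; have := Re_le_norm zy; rewrite raddfB.
Qed.

Lemma Im_continuous : continuous (@complex.Im R : R[i]^o -> R).
Proof.
move=> z; have FF : Filter (nbhs (z : R[i]^o)) by exact: nbhs_filter.
apply/cvgrPdist_le => e e0.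
have e0' : 0 < e%:C%C by rewrite ltcR.
have /cvgrPdist_le/(_ _ e0') : (y : R[i]^o) @[y --> z] --> z by exact: cvg_id.
by apply: filterS => y zy; have := Im_le_norm zy; rewrite raddfB.
Qed.

End complex_facts.

(** * Characters and the transforms of densities *)

Section fourier.
Context (R : realType) (H : topologicalZmodType)
  (theta : {measure set (borel H) -> \bar R}).
Hypotheses (sc : @second_countable H) (sf : sigma_finite setT theta)
  (thH : is_haar theta).
Implicit Types (f g : borel H -> R) (k : {compact-open, H -> R[i]^o}).

Local Notation J phi f := (\int[theta]_x (phi x * f x)).
Local Notation Rek k := (fun x : borel H => complex.Re (k x)).
Local Notation Imk k := (fun x : borel H => complex.Im (k x)).

Lemma dual_unit_bounded k : dual_group k ->
  unit_bounded (Rek k) /\ unit_bounded (Imk k).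
Proof.
case=> ck _ k1; split; split.
- apply: continuous_borel_real => x.
  by apply: (@continuous_comp _ _ _ (k : H -> R[i]^o) (@complex.Re R));
    [exact: ck | exact: Re_continuous].
- by move=> x; apply: Re_le_norm; rewrite k1.
- apply: continuous_borel_real => x.
  by apply: (@continuous_comp _ _ _ (k : H -> R[i]^o) (@complex.Im R));
    [exact: ck | exact: Im_continuous].
- by move=> x; apply: Im_le_norm; rewrite k1.
Qed.

Lemma dual_groupM (k : H -> R[i]) : dual_group k -> forall x v : H,
  complex.Re (k (x + v)) =
    complex.Re (k x) * complex.Re (k v) - complex.Im (k x) * complex.Im (k v) /\
  complex.Im (k (x + v)) =
    complex.Re (k x) * complex.Im (k v) + complex.Im (k x) * complex.Re (k v).
Proof. by case=> _ kD _ x v; rewrite kD; case: (k x) (k v) => [a b] [c e]. Qed.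

Lemma fourierE f k : dual_group k -> theta.-integrable setT (EFin \o f) ->
  fourier theta f k = Complex (J (Rek k) f) (- J (Imk k) f).
Proof.
move=> dk If; have [bR bI] := dual_unit_bounded dk.
have II := unit_bounded_integrable bI If.
congr Complex.
  by apply: eq_Rintegral => x _; case: (k x) => a b /=; rewrite mulr0 subr0.
rewrite -[- _]mulN1r -RintegralZl//; apply: eq_Rintegral => x _.
by case: (k x) => a b /=; rewrite mulr0 add0r mulN1r mulNr.
Qed.

Lemma ae_eq_fourier f g k : dual_group k ->
  theta.-integrable setT (EFin \o f) -> theta.-integrable setT (EFin \o g) ->
  {ae theta, forall x, f x = g x} -> fourier theta f k = fourier theta g k.
Proof.
move=> dk If Ig fg; have [bR bI] := dual_unit_bounded dk.
have J_ae phi : unit_bounded phi -> J phi f = J phi g.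
  move=> bp; congr fine; apply: ae_eq_integral => //.
  - exact: measurable_int (unit_bounded_integrable bp If).
  - exact: measurable_int (unit_bounded_integrable bp Ig).
  - by apply: filterS fg => x -> _.
by rewrite !fourierE// !J_ae.
Qed.

Lemma fourier_convol f g k : dual_group k -> density theta f -> density theta g ->
  fourier theta (convol theta f g) k = fourier theta f k * fourier theta g k.
Proof.
move=> dk df dg; have [bR bI] := dual_unit_bounded dk.
have If := density_integrable df; have Ig := density_integrable dg.
have dc := density_convol sc sf thH df dg.
have IRf := unit_bounded_integrable bR If; have IIf := unit_bounded_integrable bI If.
have IRg := unit_bounded_integrable bR Ig; have IIg := unit_bounded_integrable bI Ig.
rewrite !fourierE//; last exact: density_integrable.
rewrite !(weighted_integral_convol sc sf thH)//.
have IZ (a : R) phi (u : borel H -> R) : theta.-integrable setT (fun x => (phi x * u x)%:E) ->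
    theta.-integrable setT (fun x => (a * (phi x * u x))%:E).
  by move=> Iu; exact: (integrableZl measurableT a Iu).
(* The addition formula for the real part of a character separates the variables [x] and [v]; the
   imaginary part is treated alike, and together they give complex multiplication. *)
have -> : J (fun v : borel H => J (fun x : borel H => complex.Re (k ((x : H) + (v : H)))) f) g =
    J (Rek k) f * J (Rek k) g - J (Imk k) f * J (Imk k) g.
  rewrite -!RintegralZl// -RintegralB//; [|exact: IZ|exact: IZ].
  apply: eq_Rintegral => v _; rewrite !mulrA -mulrBl; congr (_ * _).
  rewrite ![_ * complex.Re _]mulrC ![_ * complex.Im _]mulrC.
  rewrite -!RintegralZl// -RintegralB//; [|exact: IZ|exact: IZ].
  apply: eq_Rintegral => x _; rewrite (dual_groupM dk x v).1; ring.
have -> : J (fun v : borel H => J (fun x : borel H => complex.Im (k ((x : H) + (v : H)))) f) g =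
    J (Rek k) f * J (Imk k) g + J (Imk k) f * J (Rek k) g.
  rewrite -!RintegralZl// -RintegralD//; [|exact: IZ|exact: IZ].
  apply: eq_Rintegral => v _; rewrite !mulrA -mulrDl; congr (_ * _).
  rewrite ![_ * complex.Re _]mulrC ![_ * complex.Im _]mulrC.
  rewrite -!RintegralZl// -RintegralD//; [|exact: IZ|exact: IZ].
  apply: eq_Rintegral => x _; rewrite (dual_groupM dk x v).2; ring.
by simpc; congr Complex; ring.
Qed.

Lemma dual_group_iter (A Ai : H -> H) n k : topgroup_automorphism A Ai ->
  dual_group k -> dual_group (iter n (dual_map A) k).
Proof.
case=> AD _ _ cA _ dk; elim: n => // n [ck kD k1]; split.
- by move=> x; exact: (continuous_comp (cA x) (ck (A x))).
- by move=> x y; rewrite iterS /dual_map AD kD.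
- by move=> x; rewrite iterS /dual_map k1.
Qed.

Lemma iter_dual_map (A : H -> H) n k x : iter n (dual_map A) k x = k (iter n A x).
Proof. by elim: n x => // n ih x; rewrite iterS /dual_map ih -iterSr. Qed.

Lemma fourier_iter_dilate (A Ai : H -> H) (alpha : R) n f k :
  topgroup_automorphism A Ai -> is_modulus theta A alpha ->
  dual_group k -> density theta f ->
  fourier theta (iter n (dilate Ai alpha) f) k = fourier theta f (iter n (dual_map A) k).
Proof.
move=> AA Aa dk df; have [bR bI] := dual_unit_bounded dk.
rewrite fourierE//; last by apply: density_integrable; exact: (density_iter_dilate AA Aa).
rewrite fourierE; [|exact: (dual_group_iter n AA dk)|exact: density_integrable].
rewrite (weighted_integral_iter_dilate n AA Aa bR df) (weighted_integral_iter_dilate n AA Aa bI df).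
by congr (Complex _ (- _)); apply: eq_Rintegral => x _; rewrite iter_dual_map.
Qed.

Lemma fourier_dist f g k : dual_group k -> theta.-integrable setT (EFin \o f) ->
  theta.-integrable setT (EFin \o g) -> forall e : R,
  (L1dist theta f g <= e%:E)%E ->
  `|fourier theta f k - fourier theta g k| <= (e + e)%:C%C.
Proof.
move=> dk If Ig e fge; have [bR bI] := dual_unit_bounded dk.
rewrite !fourierE//; apply: norm_complex_le => /=; rewrite ?opprK ?[- _ + _]addrC;
  rewrite -lee_fin; apply: le_trans fge; last first.
  rewrite L1distC; exact: weighted_integral_dist.
exact: weighted_integral_dist.
Qed.

(** Characters near [k] in the compact-open topology are uniformly close to [k] on the compact [W],
    and [g], of mass 1, vanishes off [W]. *)
Lemma fourier_continuous g (W : set H) : density theta g ->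
  (forall x, g x != 0 -> W x) -> compact W ->
  {within @dual_group R H, continuous (fourier theta g)}.
Proof.
move=> dg gW cW; apply/subspace_continuousP => k dk.
apply/cvgrPdist_le => _ /complex_gt0P[e e0 ->].
have e2 : 0 < (e / 2)%:C%C :> R[i] by rewrite ltcR divr_gt0.
have [ck _ _] := dk; have Ig := density_integrable dg.
have kW : \forall k' \near k, forall x, W x -> `|(k x : R[i]) - k' x| <= (e / 2)%:C%C.
  have cvk : {compact-open, nbhs k --> (k : H -> R[i]^o)} by exact: cvg_id.
  have := (compact_open_fam_compactP ck (nbhs_filter k)).1 cvk.
  move=> /fam_cvgP /(_ W cW); apply; apply/uniform_nbhs.
  exists [set p : R[i]^o * R[i]^o | `|p.1 - p.2| < (e / 2)%:C%C]; split.
    by rewrite -entourage_ballE; exists (e / 2)%:C%C.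
  by move=> k' h x Wx; apply: ltW; exact: h.
apply: filterS kW => k' kW dk'.
have [[bR bI] [bR' bI']] := (dual_unit_bounded dk, dual_unit_bounded dk').
rewrite /from_subspace !fourierE// [e]splitr; apply: norm_complex_le => /=.
  apply: (weighted_integral_support bR bR' dg gW) => x /kW /Re_le_norm.
  by rewrite raddfB.
rewrite opprK addrC.
apply: (weighted_integral_support bI' bI dg gW) => x /kW /Im_le_norm.
by rewrite raddfB distrC.
Qed.

Section products.
Variables (A Ai : H -> H) (alpha : R) (h g : borel H -> R).
Hypotheses (AA : topgroup_automorphism A Ai) (Aa : is_modulus theta A alpha)
  (dh : density theta h) (dg : density theta g).

Local Notation T := (dilate Ai alpha).
Local Notation G := (convol_upto theta (fun l => iter l T h)).

Lemma fourier_upto n k : dual_group k ->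
  fourier theta (G n) k = \prod_(l < n.+1) fourier theta h (iter l (dual_map A) k).
Proof.
move=> dk; elim: n => [|n ih]; first by rewrite big_ord_recl big_ord0 mulr1.
rewrite big_ord_recr /= -ih.
rewrite fourier_convol//.
- by rewrite (fourier_iter_dilate n.+1 AA Aa dk dh).
- exact: (density_upto sc sf thH AA Aa dh).
- exact: (density_iter_dilate AA Aa n.+1 dh).
Qed.

(** The function [h'] stands for the original density, which agrees with the representative [h] only
    almost everywhere but has the same transform on characters. *)
Lemma fourier_product_cvg h' :
  (forall k, dual_group k -> fourier theta h' k = fourier theta h k) ->
  L1dist theta (G n) g @[n --> \oo] --> 0%E ->
  {uniform @dual_group R H,
    (fun (n : nat) (k : {compact-open, H -> R[i]^o}) =>
       \prod_(l < n) fourier theta h' (iter l (dual_map A) k)) @ \oo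
    --> fourier theta g}.
Proof.
move=> hh' cg P /uniform_nbhs[E [entE EP]].
move: entE; rewrite -entourage_ballE => -[_ /complex_gt0P[e e0 ->] eE].
(* [fourier_dist] doubles the L1 bound, one copy for each of the real and imaginary parts; this
   leaves e/2, strictly below [e]. *)
have e4 : 0 < e / 4 by rewrite divr_gt0.
have [N hN] := cvge0_near cg e4.
(* The product of the first n+1 factors is the transform of [G n], hence the shift by one. *)
exists N.+1 => // -[//|n] /= Nn; apply: EP => k dk; apply: eE => /=.
under eq_bigr => l _ do rewrite (hh' _ (dual_group_iter l AA dk)).
rewrite -fourier_upto// /ball /= distrC.
apply: (@le_lt_trans _ _ (e / 4 + e / 4)%:C%C).
  apply: fourier_dist => //; [|exact: density_integrable|exact: hN].
  by apply: density_integrable; exact: (density_upto sc sf thH AA Aa dh).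
by rewrite ltcR; lra.
Qed.

End products.

End fourier.

(** * Bounded densities and the refinement equation *)

Section bounded_convolution.
Context (R : realType) (H : topologicalZmodType)
  (theta : {measure set (borel H) -> \bar R}).
Hypotheses (sc : @second_countable H) (sf : sigma_finite setT theta)
  (thH : is_haar theta) (hH : hausdorff_space H).

(** The increment between [x] and [y] is at most [M] times the L1 displacement of [f] under
    translation by y - x, which tends to 0. *)
Lemma convol_bounded_continuous (f h : borel H -> R) (M : R) :
  density theta f -> measurable_fun setT h -> (forall x, `|h x| <= M) ->
  continuous (convol theta f h : H -> R).
Proof.
move=> df mh hM; have [mf f0 f1] := df; have If := density_integrable df.
have M0 : 0 <= M := le_trans (normr_ge0 _) (hM 0).
have mfx (x : H) : measurable_fun setT (fun v : borel H => f (x - v : H)).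
  exact: (measurableT_comp mf (measurable_subC x)).
have Ifh (x : H) : theta.-integrable setT (fun v : borel H => (f (x - v : H) * h v)%:E).
  have Ifx : theta.-integrable setT (fun v : borel H => (M * f (x - v : H))%:E).
    apply: (@integrableZl _ _ _ theta setT measurableT M
      (fun v : borel H => (f (x - v : H))%:E)).
    apply/integrableP; split; first exact/measurable_EFinP.
    under eq_integral do rewrite abse_EFin ger0_norm//.
    rewrite (ge0_integral_subC sc sf thH x (f := EFin \o f)) ?f1 ?ltry//.
    exact/measurable_EFinP.
  apply: le_integrable Ifx => //.
    by apply/measurable_EFinP; exact: measurable_funM.
  move=> v _; rewrite lee_fin !normrM mulrC; apply: ler_wpM2r => //.
  by rewrite (le_trans (hM v))// ler_norm.
have key (x y : H) : (`|convol theta f h y - convol theta f h x|%:E <=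
    M%:E * L1dist theta (translate (y - x)%R f) f)%E.
  have ID : theta.-integrable setT
      (EFin \o (fun v : borel H => f (y - v : H) * h v - f (x - v : H) * h v)).
    exact: (integrableB measurableT (Ifh y) (Ifh x)).
  have -> : convol theta f h y - convol theta f h x =
      \int[theta]_v (f (y - v : H) * h v - f (x - v : H) * h v).
    exact: (esym (RintegralB measurableT (Ifh y) (Ifh x))).
  apply: le_trans (Rintegral_abs_le ID) _.
  have mK : measurable_fun setT (fun u => `|translate (y - x) f u - f u|%:E).
    by apply: measurable_absB => //; exact: measurable_translate.
  (* The substitution u = y - v turns u - (y - x) into x - v. *)
  rewrite /L1dist -(@ge0_integral_subC _ _ _ sc sf thH _ y mK)//.
  rewrite -ge0_integralZl//; last exact: (measurableT_comp mK (measurable_subC y)).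
  apply: ge0_le_integral => //.
  - by apply: measurable_absB; exact: measurable_funM.
  - by apply: measurable_funeM; exact: (measurableT_comp mK (measurable_subC y)).
  - move=> v _; rewrite -EFinM lee_fin -mulrBl normrM mulrC /translate.
    have -> : (y - (v : H) - (y - x) : H) = x - v by rewrite opprB [LHS]addrC subrKA.
    by rewrite [leRHS]mulrC distrC [leRHS]mulrC; apply: ler_wpM2r.
move=> x; apply/cvgrPdist_le => e e0.
have eM : 0 < e / (M + 1) by rewrite divr_gt0// ltr_wpDl.
have tc := density_translation_continuous thH hH df eM.
have : \forall y \near x, (L1dist theta (translate (y - x)%R f) f <= (e / (M + 1))%R%:E)%E.
  by move: tc; rewrite -{1}(subrr x); exact: (@shift_continuous H x x).
apply: filterS => y xy; rewrite -lee_fin distrC; apply: le_trans (key x y) _.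
apply: (@le_trans _ _ (M%:E * (e / (M + 1))%:E)%E).
  by apply: lee_wpmul2l => //; rewrite lee_fin.
rewrite -EFinM lee_fin mulrA ler_pdivrMr ?ltr_wpDl// mulrC.
by apply: ler_wpM2l; [exact: ltW | rewrite lerDl].
Qed.

End bounded_convolution.

(** * The refinement equation as a fixed-point equation for densities *)

Section solution.
Context (R : realType) (H : topologicalZmodType)
  (theta : {measure set (borel H) -> \bar R}) (A Ai : H -> H) (alpha : R).
Hypotheses (sc : @second_countable H) (sf : sigma_finite setT theta)
  (thH : is_haar theta) 
  (AA : topgroup_automorphism A Ai) (Aa : is_modulus theta A alpha).
Implicit Types (f g h : borel H -> R).
Local Notation T := (dilate Ai alpha).

Lemma Lfun1_measurable f : f \in Lfun theta 1%E -> measurable_fun setT f.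
Proof.
by move=> /Lfun1_integrable If; apply/measurable_EFinP; exact: measurable_int If.
Qed.

Lemma refinement_integral g h x : measurable_fun setT g -> measurable_fun setT h ->
  (forall x, 0 <= g x) -> (forall x, 0 <= h x) ->
  (alpha%:E * \int[theta]_v (g (Ai ((x : H) - (v : H))) * h v)%:E =
   econvol theta (EFin \o T g) (EFin \o h) x)%E.
Proof.
move=> mg mh g0 h0; have [a0 _] := Aa; rewrite -ge0_integralZl//.
- by apply: eq_integral => v _; rewrite /= -!EFinM mulrA.
- apply/measurable_EFinP; apply: measurable_funM => //.
  exact: (measurableT_comp (measurableT_comp mg (measurable_automorphism_inv AA)) (measurable_subC x)).
- by move=> v _; rewrite lee_fin mulr_ge0.
- by rewrite lee_fin ltW.
Qed.

Lemma refinement_integral_ae g g' h h' x :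
  measurable_fun setT g -> measurable_fun setT g' ->
  measurable_fun setT h -> measurable_fun setT h' ->
  {ae theta, forall x, g x = g' x} -> {ae theta, forall x, h x = h' x} ->
  (\int[theta]_v (g (Ai ((x : H) - (v : H))) * h v)%:E =
   \int[theta]_v (g' (Ai ((x : H) - (v : H))) * h' v)%:E)%E.
Proof.
move=> mg mg' mh mh' gg' hh'.
have m (u : borel H -> R) : measurable_fun setT u ->
    measurable_fun setT (fun v : borel H => u (Ai ((x : H) - (v : H)))).
  move=> mu; exact: (measurableT_comp (measurableT_comp mu (measurable_automorphism_inv AA))
    (measurable_subC x)).
apply: ae_eq_integral => //.
- by apply/measurable_EFinP/measurable_funM => //; exact: m.
- by apply/measurable_EFinP/measurable_funM => //; exact: m.
by apply: filterS2 (ae_subC sc sf thH x (ae_automorphism_inv AA Aa gg')) hh' => v /= -> ->.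
Qed.

Lemma fixed_refinement_solution g h h' : density theta g -> density theta h ->
  measurable_fun setT h' -> {ae theta, forall x, h' x = h x} ->
  {ae theta, forall x, g x = convol theta h (T g) x} ->
  refinement_solution theta Ai alpha h' g.
Proof.
move=> dg dh mh' hh' gE; have [mg g0 g1] := dg; have [mh h0 _] := dh.
have dTg := density_dilate AA Aa dg; split => //.
- by apply/Lfun1_integrable; exact: density_integrable.
- exact: aeW.
- apply: filterS2 gE (ae_convolE sc sf thH dTg dh) => x -> cE.
  rewrite (refinement_integral_ae x (g' := g) (h' := h))//; last exact: aeW.
  by rewrite refinement_integral// -cE (convolC sc sf thH).
Qed.

(** A solution is non-negative only almost everywhere; its positive part is a density in the same
    class, to which [fixed_unique] applies. *)
Lemma refinement_solution_fixed g h h' : density theta h ->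
  measurable_fun setT h' -> {ae theta, forall x, h' x = h x} ->
  refinement_solution theta Ai alpha h' g ->
  exists g', [/\ density theta g', {ae theta, forall x, g x = g' x} &
    {ae theta, forall x, g' x = convol theta h (T g') x}].
Proof.
move=> dh mh' hh' [/Lfun1_measurable mg g0 gE g1]; have [mh h0 _] := dh.
have mp : measurable_fun setT g^\+ by exact: measurable_funrpos.
have gg : {ae theta, forall x, g x = g^\+ x}.
  by apply: filterS g0 => x gx; rewrite /funrpos max_l.
have dp : density theta g^\+.
  split => //; rewrite -g1; apply: ae_eq_integral => //; try exact/measurable_EFinP.
  by apply: filterS gg => x <- _.
exists g^\+; split => //; have dTg := density_dilate AA Aa dp; have [_ p0 _] := dp.
have gg' := gg; apply: filterS2 gg' gE => x <-.
rewrite (refinement_integral_ae x mg mp mh' mh gg hh').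
rewrite (refinement_integral x mp mh p0 h0).
by rewrite (convolC sc sf thH dh dTg) convolE => <-.
Qed.

End solution.

Section density_of_probability.
Context (R : realType) (H : topologicalZmodType)
  (theta : {measure set (borel H) -> \bar R}) (nu : probability (borel H) R).
Implicit Types (h : borel H -> R).

(** Off [V] the integral of |h| is the [nu]-measure of the complement of [V], which is 0. So
    restricting the positive part of [h] to [V] changes it on a null set only. *)
Lemma probability_density h (V : set (borel H)) : measurable V ->
  h \in Lfun theta 1%E -> {ae theta, forall x, 0 <= h x} ->
  (forall B, measurable B -> nu B = (\int[theta]_(x in B) (h x)%:E)%E) ->
  nu (~` V) = 0%E ->
  exists h0, [/\ density theta h0, {ae theta, forall x, h x = h0 x} &
    forall x, h0 x != 0 -> V x].
Proof.
move=> mV Lh h0 hnu nuV; have mh := Lfun1_measurable Lh.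
have mEh : measurable_fun setT (EFin \o h) by exact/measurable_EFinP.
have mVc : measurable (~` V) by exact: measurableC.
have hV : {ae theta, forall x, ~ V x -> h x = 0}.
  have := ae_eq_integral_abs theta mVc (measurable_funTS mEh).
  case=> + _; have -> : (\int[theta]_(x in ~` V) `|(EFin \o h) x| = 0)%E.
    rewrite -nuV hnu//; apply: ae_eq_integral => //.
    - by apply: measurable_funTS; exact: measurableT_comp.
    - exact: measurable_funTS.
    - by apply: filterS h0 => x hx _ /=; rewrite ger0_norm.
  by move=> /(_ erefl); apply: filterS => x /[apply] -[].
exists (fun x => \1_V x * h^\+ x).
have hE : {ae theta, forall x, h x = \1_V x * h^\+ x}.
  apply: filterS2 h0 hV => x hx hVx; rewrite indicE /funrpos max_l//.
  have [|] := boolP (x \in V); first by rewrite mul1r.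
  by move=> /negP xV; rewrite mul0r hVx// => Vx; apply: xV; rewrite inE.
have m0 : measurable_fun setT (fun x => \1_V x * h^\+ x).
  by apply: measurable_funM; [exact: measurable_indic | exact: measurable_funrpos].
split => //.
- split => // [x|]; first by rewrite mulr_ge0// /funrpos le_max lexx orbT.
  rewrite -(probability_setT nu) hnu//; apply: ae_eq_integral => //.
    exact/measurable_EFinP.
  by apply: filterS hE => x <- _.
- move=> x; rewrite indicE; have [|_] := boolP (x \in V); first by rewrite inE.
  by rewrite mul0r eqxx.
Qed.

(** The positive total mass selects the case in which the norm is the essential supremum. *)
Lemma Linfty_ae_bounded h : (0 < theta setT)%E -> h \in Lfun theta +oo%E ->
  exists M : R, {ae theta, forall x, `|h x| <= M}.
Proof.
move=> T0 /sub_Lfun_finLfun; rewrite inE /= /finite_norm unlock T0.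
move=> /ess_supr_bounded[M hM]; exists M.
by apply: filterS hM.
Qed.

End density_of_probability.

Section evaluation.
Context (H : topologicalZmodType).

Lemma compact_translations (F : set (H -> H)) :
  compact (F : set {compact-open, H -> H}) -> compact [set f 0 | f in F].
Proof.
move=> cF; apply: (@continuous_compact _ _ (fun f : {compact-open, H -> H} => f 0)) => //.
apply: continuous_subspaceT => f U; rewrite nbhsE => -[B [oB Bf] BU].
(* Evaluation at 0 is continuous because the singleton of 0 is compact: this set is a subbasic
   neighbourhood for the compact-open topology. *)
apply: (@filterS _ _ _ [set g : {compact-open, H -> H} | g @` [set 0] `<=` B]).
  by move=> g gO; apply: BU; apply: gO; exists 0.
apply: open_nbhs_nbhs; split; last by move=> _ [_ -> <-].
by apply: compact_open_open => //; exact: compact_set1.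
Qed.

End evaluation.

Theorem proposition3p6 (R : realType) (H : topologicalZmodType)
  (d : H -> H -> R)
  (theta : {measure set (borel H) -> \bar R})
  (A Ai : H -> H) (alpha : R)
  (F : set (H -> H)) (W : set H)
  (nu : probability (borel H) R) (h : borel H -> R) :
  locally_compact [set: H] ->
  is_metric d ->
  metrizes d ->
  translation_invariant_metric d ->
  complete_metric d ->
  is_haar theta ->
  topgroup_automorphism A Ai ->
  metric_contraction d A ->
  is_modulus theta A alpha ->
  F !=set0 ->
  compact (F : set {compact-open, H -> H}) ->
  (forall f, F f -> exists v : H, forall x, f x = A x + v) ->
  is_attractor F W ->
  h \in Lfun theta 1%E ->
  {ae theta, forall x, 0 <= h x} ->
  (forall B, measurable B -> nu B = (\int[theta]_(x in B) (h x)%:E)%E) ->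
  nu (~` [set f 0 | f in F]) = 0%E ->
  exists g : borel H -> R,
  [/\ refinement_solution theta Ai alpha h g /\
      (forall g', refinement_solution theta Ai alpha h g' ->
         {ae theta, forall x, g' x = g x}),
      L1_cvg theta (convol_upto theta (rescaled Ai alpha h)) g /\
      ess_support theta g `<=` W,
      {within @dual_group R H, continuous (fourier theta g)} /\
      {uniform @dual_group R H,
        (fun (n : nat) (k : {compact-open, H -> R[i]^o}) =>
           \prod_(l < n) fourier theta h (iter l (dual_map A) k)) @ \oo
        --> fourier theta g} &
      h \in Lfun theta +oo%E ->
      exists2 gc : H -> R, continuous gc & {ae theta, forall x, g x = gc x}].
Proof.
move=> lc dm dmz dinv _ thH AA Ac Aa _ cF FA [W0 cW WE] Lh hge0 hnu nuF.
have sc := group_second_countable dm dmz AA Ac lc.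
have sf := haar_sigma_finite dm dmz AA Ac lc thH.
have hH := metrizes_hausdorff dm dmz.
set V := [set f 0 | f in F].
have mV : measurable (V : set (borel H)).
  apply: closed_borel; apply: (metrizes_compact_closed dm dmz).
  exact: compact_translations.
have mh := Lfun1_measurable Lh.
have [h0 [dh hh0 hV]] := probability_density mV Lh hge0 hnu nuF.
have [mh0 h0ge0 h01] := dh.
have WV x v : W x -> V v -> W (A x + v).
  (* Since A 0 = 0, the translation part of an affine map [f] of the family is f 0. *)
  move=> Wx [f Ff <-]; rewrite WE; exists f => //; exists x => //.
  have [u fu] := FA f Ff; rewrite !fu; congr (_ + _).
  by rewrite (automorphism0 AA) add0r.
have [g [dg gW cg]] := upto_limit dm dmz dinv Ac sc sf thH hH AA Aa dh hV W0 cW WV.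
have gE := limit_fixed sc sf thH AA Aa dh dg cg.
have clW : closed W := metrizes_compact_closed dm dmz cW.
have [mg g0 g1] := dg.
have resc l : rescaled Ai alpha h l = iter l (dilate Ai alpha) h by exact: rescaled_iter.
exists g; split.
- split; first exact: (fixed_refinement_solution sc sf thH AA Aa dg dh mh hh0 gE).
  move=> g' /(refinement_solution_fixed sc sf thH AA Aa dh mh hh0)[g'' [dg'' gg'' gE'']].
  have := fixed_unique dmz Ac sc sf thH hH AA Aa dh dg dg'' gE gE''.
  by apply: filterS2 gg'' => x ->.
- split; last first.
    move=> x xg; apply: contrapT => Wx; apply: (xg (~` W)) => //.
      exact: closed_openC.
    apply: aeW => y Wy; apply/eqP/negPn/negP => /gW; exact: Wy.
  have miter l (f : borel H -> R) : measurable_fun setT f ->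
      measurable_fun setT (iter l (dilate Ai alpha) f).
    by move=> mf; elim: l => // l ih; rewrite iterS; exact: (measurable_dilate _ AA).
  pose U := convol_upto theta (fun l => iter l (dilate Ai alpha) h0).
  have dU n : density theta (U n) by exact: (density_upto sc sf thH AA Aa dh).
  (* The statement convolves the given [h], the construction its representative [h0]. The two
     sequences agree almost everywhere at index 0 and everywhere afterwards, by [convol_ae]. *)
  have upE n : measurable_fun setT (convol_upto theta (rescaled Ai alpha h) n) /\
      {ae theta, forall x, convol_upto theta (rescaled Ai alpha h) n x = U n x}.
    elim: n => [|n [mn En]] /=; first by rewrite resc.
    have mUn : measurable_fun setT (U n) by case: (dU n).
    have -> : convol theta (convol_upto theta (rescaled Ai alpha h) n)
        (rescaled Ai alpha h n.+1) = U n.+1.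
      rewrite resc; apply: convol_ae => //; try exact: miter.
      exact: (ae_iter_dilate AA Aa).
    by split; [case: (dU n.+1) | exact: aeW].
  split.
  + move=> n; have [mn En] := upE n; apply/Lfun1_integrable.
    have IU : theta.-integrable setT (EFin \o U n) by exact: density_integrable.
    apply/integrableP; split; first exact/measurable_EFinP.
    have /integrableP[mU] := IU; rewrite (ae_eq_integral (fun x => `|(EFin \o U n) x|)%E)//.
    - by apply: measurableT_comp => //; exact/measurable_EFinP.
    - exact: measurableT_comp.
    - by apply: filterS En => x /= ->.
  + by apply/Lfun1_integrable; exact: density_integrable.
  + apply: cvg_trans cg; apply: near_eq_cvg; apply: nearW => n.
    rewrite Lnorm1; apply/esym; have [mn En] := upE n.
    by apply: (@ae_eq_L1dist _ _ _ theta) => //; [case: (dU n) | exact: aeW].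
- split; first exact: (fourier_continuous dg gW cW).
  apply: (fourier_product_cvg sc sf thH AA Aa dh dg _ cg) => k dk.
  apply: (ae_eq_fourier dk) => //; first by apply/Lfun1_integrable.
  exact: density_integrable.
- move=> hoo; have [M hM] := Linfty_ae_bounded (haar_neq0 thH) hoo.
  have dTg := density_dilate AA Aa dg; have [mTg _ _] := dTg.
  (* The truncation of [h0] at the essential bound: a representative of [h] bounded at every point,
     written with a positive part to make its measurability immediate. *)
  pose h1 (x : borel H) := `|M| - (fun y => `|M| - h0 y)^\+ x.
  have h1E x : h1 x = Num.min (h0 x) `|M|.
    rewrite /h1 /funrpos; have [hM'|/ltW hM'] := leP (h0 x) `|M|.
      by rewrite max_l ?subr_ge0// subKr.
    by rewrite max_r ?subr_le0// subr0.
  have mh1 : measurable_fun setT h1.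
    by apply: measurable_funB => //; apply: measurable_funrpos; exact: measurable_funB.
  (* The right-hand side of the fixed-point equation is the continuous representative; replacing
     [h0] by [h1] in it changes no value. *)
  exists (convol theta (dilate Ai alpha g) h1).
    apply: (convol_bounded_continuous sc sf thH hH dTg (M := `|M|)).
    - exact: mh1.
    - move=> x; rewrite h1E ger0_norm ?ge_min ?lexx ?orbT// le_min h0ge0/=.
      exact: normr_ge0.
  apply: filterS gE => x ->.
  rewrite (convolC sc sf thH dh dTg); congr (_ x); apply: convol_ae => //.
  + exact: aeW.
  + apply: filterS2 hh0 hM => y hy hMy; rewrite h1E min_l// -hy.
    by rewrite (le_trans (ler_norm _))// (le_trans hMy)// ler_norm.
Qed.
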